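(* Let $m$ be a non-negative integer, let $z$ be a real number with $|z|\ge 1$, and let $z_1,z_2,z_3\in\mathbb{C}$ be the distinct roots of $x(1-x)^2-z=0$. Then $$\sum_{k=0}^\infty \frac{H_{2k}-H_k}{(3k+1)\binom{3k}{k}}\,\frac{\binom{k}{m}}{z^{k+1}} = (-1)^m\sum_{l=1}^3\sum_{j=0}^m a_j(z_l)\left(C_j(z_l)+(-1)^jC_j(1-z_l)\right),$$ where, for $0\le r\le m$ and $\lambda\in\{z_1,z_2,z_3\}$, $$a_r(\lambda)=\frac{1}{(m-r)!}\left.\frac{d^{m-r}}{dx^{m-r}}\,\frac{x^m(1-x)^{2m}(x-\lambda)^{m+1}}{\left(x(1-x)^2-z\right)^{m+1}}\right|_{x=\lambda},$$ and $C_0$, $C_r$ ($r\ge1$) are the functions given, for $\lambda\in\mathbb{C}\setminus[0,1]$, by $$C_0(\lambda)=\mathrm{Li}_2\left(\frac1\lambda\right),\qquad C_r(\lambda)=\frac{(-1)^r}{r}\sum_{p=1}^{r-1}\frac{1}{p\,\lambda^{r-p}}\left(\frac{1}{(\lambda-1)^p}-\frac{1}{\lambda^p}\right)-\frac{(-1)^r}{r\lambda^r}\ln\left(\frac{\lambda-1}{\lambda}\right).$$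
   Context: $H_n=\sum_{k=1}^n \frac1k$ with $H_0=0$. $\mathrm{Li}_2$ is the dilogarithm, $\mathrm{Li}_2(w)=\sum_{k\ge1} w^k/k^2$ for $|w|\le1$, extended to $\mathbb{C}\setminus(1,\infty)$ by its principal branch (analytic on $\mathbb{C}\setminus[1,\infty)$). $\ln$ of a complex number is the principal branch. In $a_r(\lambda)$ the function being differentiated is understood after cancelling the factor $(x-\lambda)^{m+1}$ (removable singularity at $x=\lambda$). Empty sums are $0$, and $\binom{k}{m}=0$ for $k<m$. *)

(* Defs.v *)
(* Stdlib real numbers, with Coquelicot's complex numbers, series and integrals. *)
From Stdlib Require Import Reals Factorial Lra Lia.
From Coquelicot Require Import Coquelicot.
Open Scope C_scope.

Definition harmonic (n : nat) : R := sum_n_m (fun k => / INR k)%R 1 n.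

(* [Binomial.C n k] divides factorials with truncated subtraction, hence is
   not 0 when [n < k]. *)
Definition binom (n k : nat) : R :=
  if (k <=? n)%nat then Binomial.C n k else 0%R.

(* Principal argument, in (-PI, PI], for w <> 0. *)
Definition Carg (w : C) : R :=
  if Rle_dec 0 (Im w) then acos (Re w / Cmod w) else (- acos (Re w / Cmod w))%R.

Definition Cln (w : C) : C := (ln (Cmod w), Carg w).

(* The principal branch of the dilogarithm: its power series on the closed unit
   disc, and outside of it the continuation along the ray from the origin,
   - int_0^w ln(1-u)/u du with u = t w.  [Li2_series] and [Li2_holomorphic] below
   show that this is the analytic continuation to the plane cut along
   [1, +oo[; on the part w > 1 of the cut the value is irrelevant. *)
Definition Li2 (w : C) : C :=
  if Rle_dec (Cmod w) 1 then
    (Series (fun k => Re (w ^ S k / INR (S k) ^ 2)),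
     Series (fun k => Im (w ^ S k / INR (S k) ^ 2)))
  else
    - RInt (V := C_R_CompleteNormedModule)
        (fun t : R => Cln (1 - t * w) / t) 0 1.

(* Extension of f across a removable singularity at a; [C_lim], like
   [C_derive], is a total function agreeing with the limit when it exists. *)
Definition removable (f : C -> C) (a x : C) : C :=
  if Ceq_dec x a then C_lim f a else f x.

Fixpoint C_derive_n (f : C -> C) (n : nat) (x : C) : C :=
  match n with
  | O => f x
  | S p => C_derive (C_derive_n f p) x
  end.

Definition a_coef (m : nat) (z : R) (r : nat) (l : C) : C :=
  / INR (fact (m - r)) *
  C_derive_n
    (removable
       (fun x => x ^ m * (1 - x) ^ (2 * m) * (x - l) ^ (m + 1)
                 / (x * (1 - x) ^ 2 - z) ^ (m + 1)) l)
    (m - r) l.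

Definition C_fun (r : nat) (l : C) : C :=
  match r with
  | O => Li2 (/ l)
  | S _ =>
      (-1) ^ r / INR r *
      sum_n_m (fun p => / (INR p * l ^ (r - p)) * (/ (l - 1) ^ p - / l ^ p))
        1 (r - 1)
      - (-1) ^ r / (INR r * l ^ r) * Cln ((l - 1) / l)
  end.

Definition slit (w : C) : Prop := (0 < Re w \/ Im w <> 0)%R.

Lemma Cmod_Re_pos (w : C) : slit w -> (0 < Re w + Cmod w)%R.
Proof.
intros H.
assert (Hm : (Cmod w ^ 2 = Re w ^ 2 + Im w ^ 2)%R) by apply Cmod2_alt.
assert (H0 := Cmod_ge_0 w).
destruct H as [H | H]; [lra|].
assert (0 < Im w ^ 2)%R by nra.
destruct (Rle_lt_dec 0 (Re w)); nra.
Qed.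

Lemma slit_Cmod (w : C) : slit w -> (0 < Cmod w)%R.
Proof.
intros H. assert (H1 := Cmod_Re_pos w H). assert (H2 := re_le_Cmod w).
unfold Rabs in H2. destruct (Rcase_abs (Re w)); lra.
Qed.

Lemma Carg_atan (w : C) :
  slit w -> Carg w = (2 * atan (Im w / (Re w + Cmod w)))%R.
Proof.
intros H.
assert (Hp := Cmod_Re_pos w H). assert (Hr := slit_Cmod w H).
assert (Hm : (Cmod w ^ 2 = Re w ^ 2 + Im w ^ 2)%R) by apply Cmod2_alt.
set (x := Re w) in *. set (y := Im w) in *. set (r := Cmod w) in *.
set (u := (y / (x + r))%R).
assert (Hu : (1 + u ^ 2 = 2 * r / (x + r))%R).
{ replace (1 + u ^ 2)%R with (((x + r) ^ 2 + y ^ 2) / (x + r) ^ 2)%R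
    by (unfold u; field; lra).
  replace ((x + r) ^ 2 + y ^ 2)%R with (2 * r * (x + r))%R by nra.
  field. lra. }
assert (Hc : cos (2 * atan u) = (x / r)%R).
{ rewrite cos_2a_cos, cos_atan.
  assert (0 < 1 + Rsqr u)%R by (assert (h := Rle_0_sqr u); lra).
  replace (2 * (1 / sqrt (1 + Rsqr u)) * (1 / sqrt (1 + Rsqr u)) - 1)%R
    with (2 / (sqrt (1 + Rsqr u) * sqrt (1 + Rsqr u)) - 1)%R
    by (field; apply Rgt_not_eq, sqrt_lt_R0; assumption).
  rewrite sqrt_sqrt by lra. unfold Rsqr. replace (1 + u * u)%R with (1 + u ^ 2)%R by ring.
  rewrite Hu. field. lra. }
assert (B := atan_bound u).
unfold Carg. fold x y r. rewrite <- Hc.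
destruct (Rle_dec 0 y) as [Hy | Hy].
- assert (0 <= u)%R by (unfold u; apply Rcomplements.Rdiv_le_0_compat; lra).
  assert (0 <= atan u)%R.
  { rewrite <- atan_0. destruct H0 as [h | h]; [left; apply atan_increasing; exact h | rewrite h; lra]. }
  apply acos_cos. lra.
- assert (u < 0)%R.
  { unfold u, Rdiv. assert (0 < / (x + r))%R by (apply Rinv_0_lt_compat; lra). nra. }
  assert (atan u < 0)%R.
  { rewrite <- atan_0. apply atan_increasing. assumption. }
  rewrite <- cos_neg, acos_cos; lra.
Qed.

Definition derives (f : R -> C) (t : R) (l : C) : Prop :=
  is_derive (fun s => Re (f s)) t (Re l) /\ is_derive (fun s => Im (f s)) t (Im l).

Lemma slit_locally (a b : C) (t : R) :
  slit (a + t * b) -> locally t (fun s : R => slit (a + s * b)).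
Proof.
intros H.
assert (HR : forall s : R, Re (a + s * b) = (Re a + s * Re b)%R)
  by (intros s; destruct a, b; simpl; ring).
assert (HI : forall s : R, Im (a + s * b) = (Im a + s * Im b)%R)
  by (intros s; destruct a, b; simpl; ring).
assert (K : forall p q : R, continuous (fun s : R => p + s * q)%R t).
{ intros p q. apply (ex_derive_continuous (fun s : R => p + s * q)%R). auto_derive. trivial. }
destruct H as [H | H].
- rewrite HR in H.
  generalize (K (Re a) (Re b) _ (open_gt 0%R _ H)). unfold filtermap. apply filter_imp.
  intros s Hs. left. rewrite HR. exact Hs.
- rewrite HI in H.
  generalize (K (Im a) (Im b) _ (open_neq 0%R _ H)). unfold filtermap. apply filter_imp.
  intros s Hs. right. rewrite HI. exact Hs.
Qed.

Lemma derives_Cln (a b : C) (t : R) :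
  slit (a + t * b) -> derives (fun s => Cln (a + s * b)) t (b / (a + t * b)).
Proof.
intros H.
assert (Hl := slit_locally a b t H).
destruct a as [a1 a2], b as [b1 b2].
assert (HR : forall s : R, Re ((a1, a2) + s * (b1, b2)) = (a1 + s * b1)%R)
  by (intros s; simpl; ring).
assert (HI : forall s : R, Im ((a1, a2) + s * (b1, b2)) = (a2 + s * b2)%R)
  by (intros s; simpl; ring).
assert (HM : forall s : R, Cmod ((a1, a2) + s * (b1, b2))
  = sqrt ((a1 + s * b1) ^ 2 + (a2 + s * b2) ^ 2)).
{ intros s. unfold Cmod. fold (Re ((a1, a2) + s * (b1, b2))).
  fold (Im ((a1, a2) + s * (b1, b2))). rewrite HR, HI. reflexivity. }
assert (Hp := Cmod_Re_pos _ H). assert (Hr := slit_Cmod _ H).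
rewrite HR, HM in Hp. rewrite HM in Hr.
assert (Hs : (0 < (a1 + t * b1) ^ 2 + (a2 + t * b2) ^ 2)%R).
{ apply Rnot_le_lt. intros h. rewrite sqrt_neg_0 in Hr by exact h. lra. }
assert (Hd : (b1, b2) / ((a1, a2) + t * (b1, b2)) =
  ((b1 * (a1 + t * b1) + b2 * (a2 + t * b2)) / ((a1 + t * b1) ^ 2 + (a2 + t * b2) ^ 2),
   (b2 * (a1 + t * b1) - b1 * (a2 + t * b2)) / ((a1 + t * b1) ^ 2 + (a2 + t * b2) ^ 2))%R).
{ unfold Cdiv, Cinv, Cmult, Cplus, RtoC. simpl. 
  apply injective_projections; simpl; field; lra. }
rewrite Hd. clear Hd.
set (S := ((a1 + t * b1) ^ 2 + (a2 + t * b2) ^ 2)%R) in *.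
assert (Hq : (sqrt S * sqrt S = S)%R) by (apply sqrt_sqrt; lra).
split; simpl.
- apply (is_derive_ext (fun s => ln (sqrt ((a1 + s * b1) ^ 2 + (a2 + s * b2) ^ 2)))).
  { intros s. simpl. rewrite HM. reflexivity. }
  auto_derive.
  + change (0 < S /\ 0 < sqrt S /\ True)%R. tauto.
  + repeat match goal with |- context [sqrt ?e] => progress change (sqrt e) with (sqrt S) end.
    set (r := sqrt S) in *. clearbody r. rewrite <- Hq. field. lra.
- apply (is_derive_ext_loc (fun s => 2 * atan ((a2 + s * b2) /
     (a1 + s * b1 + sqrt ((a1 + s * b1) ^ 2 + (a2 + s * b2) ^ 2))))%R).
  { revert Hl. apply filter_imp. intros s h. rewrite Carg_atan by exact h.
    rewrite HR, HI, HM. reflexivity. }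
  auto_derive.
  + repeat match goal with |- context [sqrt ?e] => progress change (sqrt e) with (sqrt S) end.
    split; [exact Hs | split; [lra | trivial]].
  + repeat match goal with |- context [sqrt ?e] => progress change (sqrt e) with (sqrt S) end.
    assert (HS : S = ((a1 + t * b1) ^ 2 + (a2 + t * b2) ^ 2)%R) by reflexivity.
    clearbody S.
    set (x := (a1 + t * b1)%R) in *. set (y := (a2 + t * b2)%R) in *.
    set (r := sqrt S) in *. clearbody x y r. clear HM HR HI H Hl.
    assert (Hz : (x + r <> 0)%R) by lra.
    assert (E : (1 + (y * / (x + r)) ^ 2 = 2 * r / (x + r))%R).
    { replace (1 + (y * / (x + r)) ^ 2)%R with (((x + r) ^ 2 + y ^ 2) / (x + r) ^ 2)%R
        by (field; lra).
      replace ((x + r) ^ 2 + y ^ 2)%R with (2 * r * (x + r))%R by nra.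
      field. lra. }
    match goal with |- context [(/ (1 + ?e))%R] =>
      replace (1 + e)%R with (2 * r / (x + r))%R by (rewrite <- E; ring) end.
    rewrite <- Hq.
    transitivity ((b2 * r * (x + r) - y * (b1 * r + b1 * x) - b2 * y ^ 2)
      / (r * r * (x + r)))%R; [field; lra|].
    replace (y ^ 2)%R with (r * r - x ^ 2)%R by lra.
    field. lra.
Qed.

Lemma derives_bound (f : R -> C) (d : R -> C) (M : R) :
  (forall t, (0 <= t <= 1)%R -> derives f t (d t)) ->
  (forall t, (0 <= t <= 1)%R -> (Cmod (d t) <= M)%R) ->
  (Cmod (f 1%R - f 0%R) <= 2 * M)%R.
Proof.
intros Hf Hd.
assert (HP : forall P : C -> R, (forall t, (0 <= t <= 1)%R -> is_derive (fun s => P (f s)) t (P (d t))) ->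
   (forall w, Rabs (P w) <= Cmod w)%R -> (Rabs (P (f 1%R) - P (f 0%R)) <= M)%R).
{ intros P H1 H2.
  destruct (MVT_gen (fun s => P (f s)) 0 1 (fun t => P (d t))) as [c [Hc E]].
  - rewrite Rmin_left, Rmax_right by lra. intros x Hx. apply H1. lra.
  - rewrite Rmin_left, Rmax_right by lra. intros x Hx.
    apply continuity_pt_filterlim.
    apply (ex_derive_continuous (fun s => P (f s))). exists (P (d x)). apply H1. lra.
  - rewrite Rmin_left, Rmax_right in Hc by lra.
    rewrite E, Rminus_0_r, Rmult_1_r. apply Rle_trans with (1 := H2 _). apply Hd. exact Hc. }
assert (A : (Rabs (Re (f 1%R - f 0%R)) <= M)%R).
{ apply (HP Re); [intros t Ht; apply (Hf t Ht) | apply re_le_Cmod]. }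
assert (B : (Rabs (Im (f 1%R - f 0%R)) <= M)%R).
{ apply (HP Im); [intros t Ht; apply (Hf t Ht) | ].
  intros w. apply Rle_trans with (2 := Rmax_Cmod w). apply Rmax_r. }
set (w := f 1%R - f 0%R) in *.
replace w with (RtoC (Re w) + Ci * RtoC (Im w)) by (destruct w; apply injective_projections; simpl; ring).
apply Rle_trans with (1 := Cmod_triangle _ _).
rewrite Cmod_mult, Cmod_Ci, !Cmod_R. lra.
Qed.

Definition cutplane (w : C) : Prop := ~ (Im w = 0%R /\ (1 <= Re w)%R).

Lemma cutplane_dist (w : C) : cutplane w ->
  exists d : R, (0 < d)%R /\
    forall t : R, (0 <= t <= 1)%R -> (d <= Cmod (1 - t * w))%R.
Proof.
intros H. unfold cutplane in H.
assert (HR : forall t : R, (Rabs (1 - t * Re w) <= Cmod (1 - t * w))%R).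
{ intros t. replace (1 - t * Re w)%R with (Re (1 - t * w)).
  apply re_le_Cmod. destruct w; simpl; ring. }
assert (HI : forall t : R, (Rabs (t * Im w) <= Cmod (1 - t * w))%R).
{ intros t. rewrite <- Rabs_Ropp. replace (- (t * Im w))%R with (Im (1 - t * w)).
  apply Rle_trans with (2 := Rmax_Cmod _). apply Rmax_r. destruct w; simpl; ring. }
set (x := Re w) in *. set (y := Im w) in *.
destruct (Req_dec y 0) as [Hy | Hy].
- exists (Rmin 1 (1 - x)). split.
  { apply Rmin_case; [lra|]. apply Rnot_le_lt. intros h. apply H. split; [exact Hy | lra]. }
  intros t Ht. apply Rle_trans with (2 := HR t). apply Rle_trans with (2 := Rle_abs _).
  destruct (Rle_lt_dec 0 x).
  + apply Rle_trans with (1 := Rmin_r _ _). nra.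
  + apply Rle_trans with (1 := Rmin_l _ _). nra.
- assert (Hy1 : (0 < Rabs y)%R) by (apply Rabs_pos_lt; exact Hy).
  assert (Hx := Rabs_pos x). assert (Hxx := Rle_abs x).
  set (c := (2 * (Rabs x + 1))%R). assert (0 < c)%R by (unfold c; lra).
  exists (Rmin (1 / 2) (Rabs y / c)). split.
  { apply Rmin_case; [lra|]. apply Rdiv_lt_0_compat; assumption. }
  intros t Ht. destruct (Rle_lt_dec t (/ c)) as [h | h].
  + apply Rle_trans with (1 := Rmin_l _ _). apply Rle_trans with (2 := HR t).
    apply Rle_trans with (2 := Rle_abs _).
    assert (t * c <= 1)%R.
    { apply Rmult_le_reg_r with (/ c)%R; [apply Rinv_0_lt_compat; assumption|].
      rewrite Rmult_assoc, Rinv_r by lra. lra. }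
    unfold c in *. nra.
  + apply Rle_trans with (1 := Rmin_r _ _). apply Rle_trans with (2 := HI t).
    rewrite Rabs_mult, (Rabs_pos_eq t) by lra. unfold Rdiv. nra.
Qed.

Lemma slit_of_dist (w : C) (d : R) : (0 < d)%R ->
  (forall t : R, (0 <= t <= 1)%R -> (d <= Cmod (1 - t * w))%R) ->
  forall t : R, (0 <= t <= 1)%R -> slit (1 - t * w).
Proof.
intros Hd H t Ht.
assert (HR : Re (1 - t * w) = (1 - t * Re w)%R) by (destruct w; simpl; ring).
assert (HI : Im (1 - t * w) = (- (t * Im w))%R) by (destruct w; simpl; ring).
unfold slit. rewrite HR, HI.
destruct (Rlt_le_dec 0 (1 - t * Re w)) as [h | h]; [left; exact h | right].
intros E.
assert (t <> 0)%R by (intros h0; subst t; lra).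
assert (Im w = 0)%R by nra.
assert (1 <= Re w)%R by nra.
assert (Ht' : (0 <= / Re w <= 1)%R).
{ split; [left; apply Rinv_0_lt_compat; lra|].
  rewrite <- Rinv_1. apply Rinv_le_contravar; lra. }
specialize (H _ Ht').
replace (1 - RtoC (/ Re w) * w) with (RtoC 0) in H.
- rewrite Cmod_0 in H. lra.
- destruct w as [x y]. simpl in *. subst y.
  apply injective_projections; simpl; field; lra.
Qed.

Lemma cutplane_of_dist (w : C) (d : R) : (0 < d)%R ->
  (forall t : R, (0 <= t <= 1)%R -> (d <= Cmod (1 - t * w))%R) -> cutplane w.
Proof.
intros Hd H [H1 H2].
destruct (slit_of_dist w d Hd H 1%R) as [h | h]; [lra | |];
  destruct w; simpl in *; nra.
Qed.

Lemma dist_near (w v : C) (d : R) :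
  (forall t : R, (0 <= t <= 1)%R -> (d <= Cmod (1 - t * w))%R) ->
  (Cmod (v - w) <= d / 2)%R ->
  forall t : R, (0 <= t <= 1)%R -> (d / 2 <= Cmod (1 - t * v))%R.
Proof.
intros H Hv t Ht. specialize (H t Ht).
assert (E : 1 - t * w = (1 - t * v) + RtoC t * (v - w)) by ring.
assert (T := Cmod_triangle (1 - t * v) (RtoC t * (v - w))).
rewrite <- E, Cmod_mult, Cmod_R, Rabs_pos_eq in T by lra.
assert (P := Cmod_ge_0 (v - w)). nra.
Qed.

Lemma derives_plus (f g : R -> C) (t : R) (a b : C) :
  derives f t a -> derives g t b -> derives (fun s => f s + g s) t (a + b).
Proof.
intros [F1 F2] [G1 G2]. split.
- exact (is_derive_plus _ _ t _ _ F1 G1).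
- exact (is_derive_plus _ _ t _ _ F2 G2).
Qed.

Lemma derives_pow (n : nat) (c : C) (t : R) :
  derives (fun s => RtoC (s ^ S n) * c) t (RtoC (INR (S n) * t ^ n) * c).
Proof.
destruct c as [c1 c2].
split; cbv beta; rewrite ?re_scal_l, ?im_scal_l.
- apply (is_derive_ext (fun s => s ^ S n * c1)%R).
  { intros s. rewrite re_scal_l. reflexivity. }
  auto_derive; [trivial|]. unfold Re, fst. change (pred (S n)) with n; change (match n with 0%nat => 1%R | S _ => (INR n + 1)%R end) with (INR (S n)); ring.
- apply (is_derive_ext (fun s => s ^ S n * c2)%R).
  { intros s. rewrite im_scal_l. reflexivity. }
  auto_derive; [trivial|]. unfold Im, snd. change (pred (S n)) with n; change (match n with 0%nat => 1%R | S _ => (INR n + 1)%R end) with (INR (S n)); ring.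
Qed.

Definition cont (f : R -> C) (t : R) : Prop :=
  continuous (fun s => Re (f s)) t /\ continuous (fun s => Im (f s)) t.

Lemma cont_ex_RInt (f : R -> C) :
  (forall t, (0 <= t <= 1)%R -> cont f t) ->
  exists l : C, is_RInt (V := C_R_NormedModule) f 0 1 l.
Proof.
intros H.
destruct (ex_RInt_continuous (fun s => Re (f s)) 0 1) as [l1 H1].
{ rewrite Rmin_left, Rmax_right by lra. intros t Ht. apply (H t Ht). }
destruct (ex_RInt_continuous (fun s => Im (f s)) 0 1) as [l2 H2].
{ rewrite Rmin_left, Rmax_right by lra. intros t Ht. apply (H t Ht). }
exists (l1, l2).
exact (is_RInt_fct_extend_pair (U := R_NormedModule) (V := R_NormedModule) f 0 1 l1 l2 H1 H2).
Qed.

Lemma is_RInt_Cmult (f : R -> C) (c l : C) :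
  is_RInt (V := C_R_NormedModule) f 0 1 l ->
  is_RInt (V := C_R_NormedModule) (fun t => c * f t) 0 1 (c * l).
Proof.
intros H.
assert (H1 : is_RInt (fun t => Re (f t)) 0 1 (Re l))
  by exact (is_RInt_fct_extend_fst (U := R_NormedModule) (V := R_NormedModule) f 0 1 l H).
assert (H2 : is_RInt (fun t => Im (f t)) 0 1 (Im l))
  by exact (is_RInt_fct_extend_snd (U := R_NormedModule) (V := R_NormedModule) f 0 1 l H).
apply (is_RInt_fct_extend_pair (U := R_NormedModule) (V := R_NormedModule)
  (fun t => c * f t) 0 1
  (Re c * Re l - Im c * Im l)%R (Re c * Im l + Im c * Re l)%R).
- exact (is_RInt_minus _ _ _ _ _ _ (is_RInt_scal _ _ _ (Re c) _ H1) (is_RInt_scal _ _ _ (Im c) _ H2)).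
- exact (is_RInt_plus _ _ _ _ _ _ (is_RInt_scal _ _ _ (Re c) _ H2) (is_RInt_scal _ _ _ (Im c) _ H1)).
Qed.

Lemma norm_C_R (x : C) : norm (K := R_AbsRing) (V := C_R_NormedModule) x = Cmod x.
Proof.
unfold Cmod. change (norm (K := R_AbsRing) (V := C_R_NormedModule) x)
  with (sqrt (Rabs (fst x) ^ 2 + Rabs (snd x) ^ 2)).
rewrite !pow2_abs. reflexivity.
Qed.

(* The integrand of Li2, extended by continuity at 0. *)
Definition ray (w : C) (t : R) : C :=
  if Req_dec_T t 0 then - w else Cln (1 - t * w) / t.

Lemma Cln_1 : Cln 1 = 0.
Proof.
unfold Cln. rewrite Cmod_1, ln_1. unfold Carg. simpl.
destruct (Rle_dec 0 0) as [_ | h]; [|lra].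
rewrite Cmod_1, Rdiv_1_r, acos_1. reflexivity.
Qed.

Lemma derives_ray (w : C) (t : R) : slit (1 - t * w) ->
  derives (fun s => Cln (1 - s * w)) t (- w / (1 - t * w)).
Proof.
intros H.
assert (E : forall s : R, 1 - s * w = 1 + s * - w) by (intros; ring).
rewrite E in H |- *.
destruct (derives_Cln 1 (- w) t H) as [D1 D2].
split.
- apply is_derive_ext with (2 := D1). intros s. simpl. rewrite E. reflexivity.
- apply is_derive_ext with (2 := D2). intros s. simpl. rewrite E. reflexivity.
Qed.

Lemma slope_continuous_0 (L : R -> R) (l : R) :
  L 0%R = 0%R -> is_derive L 0 l ->
  continuous (fun t => if Req_dec_T t 0 then l else (L t / t)%R) 0.
Proof.
intros H0 H. apply is_derive_Reals in H.
intros P [eps HP]. destruct (H eps (cond_pos eps)) as [del Hd].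
exists del. intros t Ht. apply HP.
destruct (Req_dec_T 0 0) as [_ | h]; [|lra].
destruct (Req_dec_T t 0) as [h | h]; [apply ball_center|].
assert (Ht' : (Rabs t < del)%R).
{ change (Rabs (t - 0) < del)%R in Ht. rewrite Rminus_0_r in Ht. exact Ht. }
specialize (Hd t h Ht'). rewrite Rplus_0_l, H0, Rminus_0_r in Hd. exact Hd.
Qed.

Lemma Re_div_R (z : C) (t : R) : t <> 0%R -> Re (z / t) = (Re z / t)%R.
Proof. intros H. destruct z; simpl; field; assumption. Qed.

Lemma Im_div_R (z : C) (t : R) : t <> 0%R -> Im (z / t) = (Im z / t)%R.
Proof. intros H. destruct z; simpl; field; assumption. Qed.

Lemma slope_continuous (P : C -> R) (L : R -> C) (w l : C) (t : R) :
  (forall (z : C) (s : R), s <> 0%R -> P (z / s) = (P z / s)%R) ->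
  P 0 = 0%R -> L 0%R = 0 -> (t = 0%R -> l = - w) ->
  is_derive (fun s => P (L s)) t (P l) ->
  continuous (fun s => P (if Req_dec_T s 0 then - w else L s / s)) t.
Proof.
intros HP P0 L0 Hl D.
destruct (Req_dec t 0) as [h | h].
- subst t. rewrite (Hl eq_refl) in D.
  apply continuous_ext with (fun s => if Req_dec_T s 0 then P (- w) else (P (L s) / s)%R).
  { intros s. destruct (Req_dec_T s 0); [reflexivity | rewrite HP; trivial]. }
  apply slope_continuous_0; [rewrite L0; exact P0 | exact D].
- apply continuous_ext_loc with (fun s => (P (L s) * / s)%R).
  { generalize (open_neq 0%R t h). apply filter_imp. intros s hs.
    destruct (Req_dec_T s 0); [contradiction | rewrite HP; trivial]. }
  apply (continuous_mult (K := R_AbsRing) (fun s => P (L s)) (fun s => / s)%R).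
  + apply (ex_derive_continuous (fun s => P (L s))). exists (P l). exact D.
  + apply continuous_Rinv. exact h.
Qed.

Lemma cont_ray (w : C) (t : R) : slit (1 - t * w) -> cont (ray w) t.
Proof.
intros H. destruct (derives_ray w t H) as [D1 D2].
assert (L0 : Cln (1 - 0%R * w) = 0).
{ replace (1 - 0%R * w) with (RtoC 1) by ring. exact Cln_1. }
assert (Hl : t = 0%R -> - w / (1 - t * w) = - w).
{ intros h. rewrite h. replace (1 - 0%R * w) with (RtoC 1) by ring. field. }
split; unfold ray.
- apply (slope_continuous Re (fun s => Cln (1 - s * w)) w _ t Re_div_R eq_refl L0 Hl D1).
- apply (slope_continuous Im (fun s => Cln (1 - s * w)) w _ t Im_div_R eq_refl L0 Hl D2).
Qed.

Lemma cont_inv (w : C) (t : R) : slit (1 - t * w) -> cont (fun s => / (1 - s * w)) t.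
Proof.
intros H. assert (Hp := slit_Cmod _ H). assert (E := Cmod2_alt (1 - t * w)).
destruct w as [x y].
replace (Re (1 - t * (x, y))) with (1 - t * x)%R in E by (simpl; ring).
replace (Im (1 - t * (x, y))) with (- (t * y))%R in E by (simpl; ring).
assert (HN : ((1 - t * x) ^ 2 + (t * y) ^ 2 <> 0)%R) by nra.
split.
- apply continuous_ext with (fun s => (1 - s * x) / ((1 - s * x) ^ 2 + (s * y) ^ 2))%R.
  { intros s. simpl. apply f_equal2; ring. }
  apply (ex_derive_continuous (fun s => (1 - s * x) / ((1 - s * x) ^ 2 + (s * y) ^ 2))%R).
  auto_derive. simpl in HN. contradict HN. rewrite <- HN. ring.
- apply continuous_ext with (fun s => (s * y) / ((1 - s * x) ^ 2 + (s * y) ^ 2))%R.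
  { intros s. simpl. apply f_equal2; ring. }
  apply (ex_derive_continuous (fun s => (s * y) / ((1 - s * x) ^ 2 + (s * y) ^ 2))%R).
  auto_derive. simpl in HN. contradict HN. rewrite <- HN. ring.
Qed.

Local Notation csum := (sum_n (G := AbelianGroup.AbelianMonoid C_AbelianGroup)).

Ltac as_C := match goal with |- @eq _ ?a ?b => change (@eq C a b) end.

Lemma ray_estimate (w v : C) (d : R) : (0 < d)%R ->
  (forall t : R, (0 <= t <= 1)%R -> (d <= Cmod (1 - t * w))%R) ->
  (Cmod (v - w) <= d / 2)%R ->
  forall t : R, (0 <= t <= 1)%R ->
  (Cmod (ray v t - ray w t + (v - w) * / (1 - t * w)) <= 8 / d ^ 2 * Cmod (v - w) ^ 2)%R.
Proof.
intros Hd H Hv t Ht. unfold ray.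
assert (Hh := Cmod_ge_0 (v - w)).
assert (HK : (0 <= 8 / d ^ 2)%R) by (apply Rcomplements.Rdiv_le_0_compat; nra).
destruct (Req_dec_T t 0) as [h | h].
{ subst t. replace (- v - - w + (v - w) * / (1 - 0%R * w)) with (RtoC 0).
  - rewrite Cmod_0. apply Rmult_le_pos; [exact HK | nra].
  - replace (1 - 0%R * w) with (RtoC 1) by ring. field. }
assert (Ht0 : (0 < t)%R) by lra. assert (Htc : RtoC t <> 0) by (intros E; apply RtoC_inj in E; lra).
set (D := v - w) in *.
assert (Hs : forall s : R, (0 <= s <= 1)%R -> (d / 2 <= Cmod ((1 - t * w) + s * - (t * D)))%R).
{ intros s Hs. replace ((1 - t * w) + s * - (t * D)) with (1 - t * (w + s * D)) by ring.
  apply (dist_near w); trivial.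
  replace (w + s * D - w) with (RtoC s * D) by ring.
  rewrite Cmod_mult, Cmod_R, Rabs_pos_eq by lra. nra. }
assert (Hslit : forall s : R, (0 <= s <= 1)%R -> slit ((1 - t * w) + s * - (t * D))).
{ intros s hs. replace ((1 - t * w) + s * - (t * D)) with (1 - t * (w + s * D)) by ring.
  apply (slit_of_dist (w + s * D) (d / 2)); [lra | | exact Ht].
  apply (dist_near w); trivial.
  replace (w + s * D - w) with (RtoC s * D) by ring.
  rewrite Cmod_mult, Cmod_R, Rabs_pos_eq by lra. nra. }
assert (Nz : forall z : C, (0 < Cmod z)%R -> z <> 0) by (intros z hz; apply Cmod_gt_0; exact hz).
assert (N1 : 1 - t * w <> 0) by (apply Nz; specialize (H t Ht); lra).
assert (B := derives_bound
  (fun s => Cln ((1 - t * w) + s * - (t * D)) + RtoC (s ^ 1) * (t * D / (1 - t * w)))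
  (fun s => - (t * D) / ((1 - t * w) + s * - (t * D)) + RtoC (INR 1 * s ^ 0) * (t * D / (1 - t * w)))
  (t ^ 2 * Cmod D ^ 2 * (4 / d ^ 2))).
assert (B' : (Cmod (t * (Cln (1 - t * v) / t - Cln (1 - t * w) / t + D * / (1 - t * w)))
   <= 2 * (t ^ 2 * Cmod D ^ 2 * (4 / d ^ 2)))%R).
{ eapply Rle_trans; [right | apply B].
  - apply f_equal.
    replace ((1 - t * w) + 1%R * - (t * D)) with (1 - t * v) by (unfold D; ring).
    replace ((1 - t * w) + 0%R * - (t * D)) with (1 - t * w) by ring.
    rewrite !pow_1. field. split; assumption.
  - intros s hs. apply derives_plus; [apply derives_Cln; apply Hslit; exact hs | apply derives_pow].
  - intros s hs. assert (Q := Hs s hs). assert (N2 := Nz _ (Rlt_le_trans _ _ _ (Rdiv_lt_0_compat _ 2 Hd Rlt_0_2) Q)).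
    simpl INR. simpl pow at 1. rewrite Rmult_1_r.
    replace (- (t * D) / (1 - t * w + s * - (t * D)) + 1 * (t * D / (1 - t * w)))
      with (- ((RtoC t * D) * (RtoC t * D) * RtoC s) / ((1 - t * w + s * - (t * D)) * (1 - t * w)))
      by (field; split; assumption).
    rewrite Cmod_div by (apply Cmult_neq_0; assumption).
    rewrite Cmod_opp, !Cmod_mult, !Cmod_R, (Rabs_pos_eq t), (Rabs_pos_eq s) by lra.
    set (p := Cmod (1 - t * w + s * - (t * D))) in *.
    assert (Hq := H t Ht). set (q := Cmod (1 - t * w)) in *.
    set (e := Cmod D) in *.
    apply Rle_trans with ((t * e * (t * e) * 1) / (d ^ 2 / 4))%R.
    + apply Rmult_le_compat.
      * assert (0 <= t * e)%R by nra. assert (0 <= t * e * (t * e))%R by nra. nra.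
      * left. apply Rinv_0_lt_compat. nra.
      * assert (0 <= t * e)%R by nra. assert (0 <= t * e * (t * e))%R by nra. nra.
      * apply Rinv_le_contravar; nra.
    + right. field. lra. }
rewrite Cmod_mult, Cmod_R, Rabs_pos_eq in B' by lra.
set (X := Cmod (Cln (1 - t * v) / t - Cln (1 - t * w) / t + D * / (1 - t * w))) in *.
assert (HX : (X <= t * (8 / d ^ 2 * Cmod D ^ 2))%R).
{ apply Rmult_le_reg_l with t; [exact Ht0|]. apply Rle_trans with (1 := B').
  right. field. lra. }
assert (0 <= 8 / d ^ 2 * Cmod D ^ 2)%R by (apply Rmult_le_pos; nra).
nra.
Qed.

Lemma cutplane_RInt (w : C) : cutplane w ->
  exists l : C, is_RInt (V := C_R_NormedModule) (ray w) 0 1 l.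
Proof.
intros H. destruct (cutplane_dist w H) as [d [Hd Hw]].
apply cont_ex_RInt. intros t Ht. apply cont_ray. apply (slit_of_dist w d); assumption.
Qed.

Lemma geometric (x : C) (n : nat) :
  (1 - x) * csum (fun k => x ^ k) n = 1 - x ^ S n.
Proof.
induction n as [|n IH].
- rewrite sum_O. simpl. ring.
- rewrite sum_Sn. change plus with Cplus.
  rewrite Cmult_plus_distr_l, IH. simpl. ring.
Qed.

Lemma sum_n_Cmult (c : C) (a : nat -> C) (n : nat) :
  csum (fun k => c * a k) n = c * csum a n.
Proof. exact (sum_n_mult_l (K := C_Ring) c a n). Qed.

Lemma derives_sum (f : nat -> R -> C) (l : nat -> C) (t : R) (n : nat) :
  (forall k, derives (f k) t (l k)) ->
  derives (fun s => csum (fun k => f k s) n) t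
    (csum l n).
Proof.
intros H. induction n as [|n IH].
- destruct (H 0%nat) as [H1 H2]. rewrite sum_O. split.
  + apply is_derive_ext with (2 := H1). intros s. rewrite sum_O. reflexivity.
  + apply is_derive_ext with (2 := H2). intros s. rewrite sum_O. reflexivity.
- destruct (derives_plus _ _ _ _ _ IH (H (S n))) as [H1 H2]. rewrite sum_Sn. split.
  + apply is_derive_ext with (2 := H1). intros s. rewrite sum_Sn. reflexivity.
  + apply is_derive_ext with (2 := H2). intros s. rewrite sum_Sn. reflexivity.
Qed.

Definition Li2_term (w : C) (k : nat) : C := w ^ S k / INR (S k) ^ 2.

Lemma ray_series_estimate (w : C) (d : R) (n : nat) : (0 < d)%R ->
  (forall t : R, (0 <= t <= 1)%R -> (d <= Cmod (1 - t * w))%R) ->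
  (Cmod w <= 1)%R ->
  forall t : R, (0 <= t <= 1)%R ->
  (Cmod (ray w t + csum
      (fun k => (RtoC (t ^ k) * (w ^ S k / INR (S k)))%C) n) <= 2 / d * t ^ S n)%R.
Proof.
intros Hd H Hw t Ht. unfold ray.
destruct (Req_dec_T t 0) as [h | h].
{ subst t. replace (sum_n _ n) with w.
  - replace (- w + w) with (RtoC 0) by ring. rewrite Cmod_0, pow_i by lia. lra.
  - induction n as [|n IH].
    + rewrite sum_O. simpl. as_C; field.
    + rewrite sum_Sn, <- IH, pow_i by lia. change plus with Cplus. as_C; ring. }
assert (Ht0 : (0 < t)%R) by lra. assert (Htc : RtoC t <> 0) by (intros E; apply RtoC_inj in E; lra).
set (v := t * w).
assert (Hv : (Cmod v <= t)%R).
{ unfold v. rewrite Cmod_mult, Cmod_R, Rabs_pos_eq by lra. nra. }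
assert (Hs : forall s : R, (0 <= s <= 1)%R -> 1 + s * - v = 1 - (s * t)%R * w /\ (0 <= s * t <= 1)%R).
{ intros s hs. split; [rewrite RtoC_mult; unfold v; ring | nra]. }
assert (B := derives_bound
  (fun s => Cln (1 + s * - v) + csum
      (fun k => RtoC (s ^ S k) * (v ^ S k / INR (S k))) n)
  (fun s => - v / (1 + s * - v) + csum
      (fun k => RtoC (INR (S k) * s ^ k) * (v ^ S k / INR (S k))) n)
  (t * t ^ S n / d)).
assert (B' : (Cmod (t * (Cln (1 - v) / t + csum
      (fun k => (RtoC (t ^ k) * (w ^ S k / INR (S k)))%C) n)) <= 2 * (t * t ^ S n / d))%R).
{ eapply Rle_trans; [right | apply B].
  - apply f_equal.
    replace (1 + 1%R * - v) with (1 - v) by ring.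
    replace (1 + 0%R * - v) with (RtoC 1) by ring.
    rewrite Cln_1.
    replace (csum (fun k => RtoC (0 ^ S k) * (v ^ S k / INR (S k))) n) with (RtoC 0).
    + rewrite Cmult_plus_distr_l, <- sum_n_Cmult.
      replace (t * (Cln (1 - v) / t)) with (Cln (1 - v)) by (field; exact Htc).
      replace (csum (fun k : nat => t * ((t ^ k)%R * (w ^ S k / INR (S k)))) n)
        with (csum (fun k => RtoC (1 ^ S k) * (v ^ S k / INR (S k))) n).
      * ring.
      * apply sum_n_ext. intros k. unfold v. rewrite Cpow_mult_l, pow1, RtoC_pow.
        simpl Cpow. unfold Cdiv. as_C; ring.
    + symmetry. clear. induction n as [|n IH].
      * rewrite sum_O, pow_i by lia. as_C; ring.
      * rewrite sum_Sn, IH, pow_i by lia. change plus with Cplus. as_C; ring.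
  - intros s hs. destruct (Hs s hs) as [E1 E2]. apply derives_plus.
    + apply derives_Cln. rewrite E1. apply (slit_of_dist w d); assumption.
    + apply derives_sum. intros k. apply derives_pow.
  - intros s hs. destruct (Hs s hs) as [E1 E2].
    assert (Q := H _ E2). rewrite <- E1 in Q.
    assert (N : 1 + s * - v <> 0) by (apply Cmod_gt_0; lra).
    replace (csum (fun k => RtoC (INR (S k) * s ^ k) * (v ^ S k / INR (S k))) n)
      with (v * csum (fun k => (RtoC s * v) ^ k) n).
    + assert (G := geometric (RtoC s * v) n).
      replace (- v / (1 + s * - v) + v * csum (fun k : nat => (s * v) ^ k) n)
        with (- (v * (s * v) ^ S n) / (1 + s * - v)).
      * rewrite Cmod_div by exact N. rewrite Cmod_opp, Cmod_mult, Cmod_pow, Cmod_mult, Cmod_R, Rabs_pos_eq by lra.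
        assert (Hc := Cmod_ge_0 v).
        apply Rmult_le_compat.
        -- apply Rmult_le_pos; [exact Hc | apply pow_le; nra].
        -- left. apply Rinv_0_lt_compat. lra.
        -- apply Rmult_le_compat; [exact Hc | apply pow_le; nra | exact Hv |].
           apply pow_incr. nra.
        -- apply Rinv_le_contravar; lra.
      * replace (1 - s * v) with (1 + s * - v) in G by ring.
        set (Sg := sum_n _ n) in *.
        replace Sg with ((1 - (s * v) ^ S n) / (1 + s * - v)) by (rewrite <- G; field; exact N).
        field. exact N.
    + rewrite <- sum_n_Cmult. apply sum_n_ext. intros k.
      assert (Nk : RtoC (INR (S k)) <> 0).
      { intros E. apply RtoC_inj in E. apply (not_0_INR (S k)); [lia | exact E]. }
      rewrite RtoC_mult, RtoC_pow, Cpow_mult_l. simpl Cpow. as_C; field. exact Nk. }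
rewrite Cmod_mult, Cmod_R, Rabs_pos_eq in B' by lra.
apply Rmult_le_reg_l with t; [exact Ht0|]. apply Rle_trans with (1 := B').
right. field. lra.
Qed.

Lemma Re_csum (a : nat -> C) (n : nat) : Re (csum a n) = sum_n (fun k => Re (a k)) n.
Proof.
induction n as [|n IH]; [rewrite !sum_O; reflexivity|].
rewrite !sum_Sn, <- IH. reflexivity.
Qed.

Lemma Im_csum (a : nat -> C) (n : nat) : Im (csum a n) = sum_n (fun k => Im (a k)) n.
Proof.
induction n as [|n IH]; [rewrite !sum_O; reflexivity|].
rewrite !sum_Sn, <- IH. reflexivity.
Qed.

Lemma is_series_C (a : nat -> C) (l : C) :
  is_series (V := C_NormedModule) a l <->
  is_series (fun k => Re (a k)) (Re l) /\ is_series (fun k => Im (a k)) (Im l).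
Proof.
unfold is_series. split.
- intros H. split; apply filterlim_locally; intros eps;
    generalize (proj1 (filterlim_locally (U := C_UniformSpace) _ l) H eps);
    apply filter_imp; intros n [h1 h2].
  + rewrite <- Re_csum. exact h1.
  + rewrite <- Im_csum. exact h2.
- intros [H1 H2]. apply (filterlim_locally (U := C_UniformSpace)). intros eps.
  generalize (filter_and _ _ (proj1 (filterlim_locally _ (Re l)) H1 eps)
    (proj1 (filterlim_locally _ (Im l)) H2 eps)).
  apply filter_imp. intros n [h1 h2]. rewrite <- Re_csum in h1. rewrite <- Im_csum in h2.
  split; assumption.
Qed.

Lemma is_RInt_pow_term (c : C) (k : nat) :
  is_RInt (V := C_R_NormedModule) (fun t => RtoC (t ^ k) * (c / INR (S k))) 0 1 (c / INR (S k) ^ 2).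
Proof.
assert (N : INR (S k) <> 0%R) by (apply not_0_INR; lia).
assert (NC : RtoC (INR (S k)) <> 0) by (intros E; apply RtoC_inj in E; exact (N E)).
assert (H : is_RInt (V := R_NormedModule) (fun t => (t ^ k)%R) 0 1 (/ INR (S k))%R).
{ replace (/ INR (S k))%R with (minus ((fun t => t ^ S k / INR (S k))%R 1%R) ((fun t => t ^ S k / INR (S k))%R 0%R)).
  - apply (is_RInt_derive (V := R_CompleteNormedModule) (fun t => t ^ S k / INR (S k))%R (fun t => t ^ k)%R 0 1).
    + intros x _. auto_derive; [trivial|].
      change (pred (S k)) with k.
      change (match k with 0%nat => 1%R | S _ => (INR k + 1)%R end) with (INR (S k)).
      field. exact N.
    + intros x _. apply (ex_derive_continuous (fun t => t ^ k)%R). auto_derive. trivial.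
  - unfold minus, plus, opp; simpl plus; cbv beta. change (1 ^ S k / INR (S k) + - (0 ^ S k / INR (S k)) = / INR (S k))%R.
    rewrite pow1, pow_i by lia. field. exact N. }
assert (H' : is_RInt (V := C_R_NormedModule) (fun t => RtoC (t ^ k)) 0 1 (RtoC (/ INR (S k)))).
{ apply (is_RInt_fct_extend_pair (U := R_NormedModule) (V := R_NormedModule)
    (fun t => RtoC (t ^ k)) 0 1 (/ INR (S k))%R 0%R H).
  assert (Z := is_RInt_const (V := R_NormedModule) 0 1 0%R).
  change (scal (1 - 0)%R 0%R) with ((1 - 0) * 0)%R in Z. rewrite Rmult_0_r in Z. exact Z. }
replace (c / INR (S k) ^ 2) with (c / INR (S k) * RtoC (/ INR (S k))).
- apply is_RInt_ext with (2 := is_RInt_Cmult _ (c / INR (S k)) _ H').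
  intros t _. as_C. ring.
- rewrite RtoC_inv by exact N. field. exact NC.
Qed.

Lemma is_RInt_csum (f : nat -> R -> C) (l : nat -> C) (n : nat) :
  (forall k, is_RInt (V := C_R_NormedModule) (f k) 0 1 (l k)) ->
  is_RInt (V := C_R_NormedModule) (fun t => csum (fun k => f k t) n) 0 1 (csum l n).
Proof.
intros H. induction n as [|n IH].
- rewrite sum_O. apply is_RInt_ext with (2 := H 0%nat). intros t _. rewrite sum_O. reflexivity.
- rewrite sum_Sn. apply is_RInt_ext with (2 := is_RInt_plus _ _ _ _ _ _ IH (H (S n))).
  intros t _. rewrite sum_Sn. reflexivity.
Qed.

Lemma ray_series (w l : C) : cutplane w -> (Cmod w <= 1)%R ->
  is_RInt (V := C_R_NormedModule) (ray w) 0 1 l ->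
  is_series (V := C_NormedModule) (fun k => w ^ S k / INR (S k) ^ 2) (- l).
Proof.
intros Hc Hw Hl. destruct (cutplane_dist w Hc) as [d [Hd H]].
assert (E : forall n : nat,
  (Cmod (csum (fun k => (w ^ S k / INR (S k) ^ 2)%C) n - - l)%C <= 2 / d * / INR (S (S n)))%R).
{ intros n.
  assert (A := is_RInt_plus _ _ _ _ _ _ Hl
     (is_RInt_csum _ _ n (fun k => is_RInt_pow_term (w ^ S k) k))).
  assert (P : is_RInt (V := R_NormedModule) (fun t => 2 / d * t ^ S n)%R 0 1 (2 / d * / INR (S (S n)))%R).
  { apply (is_RInt_scal (V := R_NormedModule) (fun t => t ^ S n)%R 0 1 (2 / d)).
    assert (Q := is_RInt_fct_extend_fst (U := R_NormedModule) (V := R_NormedModule) _ 0 1 _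
       (is_RInt_pow_term (INR (S (S n))) (S n))).
    assert (N : INR (S (S n)) <> 0%R) by (apply not_0_INR; lia).
    assert (NC : RtoC (INR (S (S n))) <> 0) by (intros e; apply RtoC_inj in e; exact (N e)).
    replace (RtoC (INR (S (S n))) / INR (S (S n)) ^ 2) with (RtoC (/ INR (S (S n)))) in Q
      by (rewrite RtoC_inv by exact N; field; exact NC).
    apply is_RInt_ext with (2 := Q). intros t _.
    replace (RtoC (INR (S (S n))) / INR (S (S n))) with (RtoC 1) by (field; exact NC).
    simpl. ring. }
  assert (B := norm_RInt_le _ _ 0 1 _ _ Rle_0_1
     (fun t Ht => Rle_trans _ _ _ (Req_le _ _ (norm_C_R _)) (ray_series_estimate w d n Hd H Hw t Ht)) A P).
  rewrite norm_C_R in B. eapply Rle_trans; [right | exact B].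
  apply f_equal. change plus with Cplus. as_C. ring. }
unfold is_series. apply (filterlim_locally_ball_norm (K := C_AbsRing) (U := C_NormedModule)).
intros eps.
assert (L : is_lim_seq (fun n => 2 / d * / INR (S (S n)))%R (2 / d * 0)%R).
{ apply (is_lim_seq_scal_l (fun n => / INR (S (S n)))%R (2 / d) 0%R).
  apply (is_lim_seq_incr_1 (fun n => / INR (S n))%R).
  apply (is_lim_seq_incr_1 (fun n => / INR n)%R).
  replace (Finite 0) with (Rbar_inv p_infty) by reflexivity.
  apply is_lim_seq_inv; [apply is_lim_seq_INR | discriminate]. }
rewrite Rmult_0_r in L. apply is_lim_seq_spec in L.
generalize (L eps). apply filter_imp. intros n hn.
rewrite Rminus_0_r in hn. apply Rle_lt_trans with (2 := Rle_lt_trans _ _ _ (Rle_abs _) hn).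
exact (E n).
Qed.

Lemma ex_series_inv_sqr : ex_series (fun k => / INR (S k) ^ 2)%R.
Proof.
apply (ex_series_le (K := R_AbsRing) (V := R_CompleteNormedModule)
  _ (fun k => 2 * (/ INR (S k) - / INR (S (S k))))%R).
- intros k. assert (N : (1 <= INR (S k))%R) by (apply (le_INR 1); lia).
  assert (E : INR (S (S k)) = (INR (S k) + 1)%R) by apply S_INR.
  set (x := INR (S k)) in *. rewrite E.
  assert (P : (0 < / x ^ 2)%R) by (apply Rinv_0_lt_compat; nra).
  change (Rabs (/ x ^ 2) <= 2 * (/ x - / (x + 1)))%R.
  rewrite Rabs_pos_eq by lra.
  replace (2 * (/ x - / (x + 1)))%R with (/ (x * (x + 1) / 2))%R by (field; lra).
  apply Rinv_le_contravar; nra.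
- exists (2 * (1 - 0))%R. apply (is_series_scal_l (K := R_AbsRing) 2%R (fun k => / INR (S k) - / INR (S (S k)))%R (1 - 0)%R).
  assert (S0 : forall n, sum_n (fun k => / INR (S k) - / INR (S (S k)))%R n = (1 - / INR (S (S n)))%R).
  { induction n as [|n IH].
    - rewrite sum_O. simpl. lra.
    - rewrite sum_Sn, IH. change plus with Rplus. change (1 - / INR (S (S n)) + (/ INR (S (S n)) - / INR (S (S (S n)))) = 1 - / INR (S (S (S n))))%R. ring. }
  apply (is_lim_seq_ext (fun n => 1 - / INR (S (S n)))%R _ (1 - 0)%R).
  { intros n. rewrite S0. reflexivity. }
  apply is_lim_seq_minus'; [apply is_lim_seq_const|].
  apply (is_lim_seq_incr_1 (fun n => / INR (S n))%R).
  apply (is_lim_seq_incr_1 (fun n => / INR n)%R).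
  replace (Finite 0) with (Rbar_inv p_infty) by reflexivity.
  apply is_lim_seq_inv; [apply is_lim_seq_INR | discriminate].
Qed.

Lemma Li2_series (w : C) : (Cmod w <= 1)%R ->
  is_series (V := C_NormedModule) (fun k => w ^ S k / INR (S k) ^ 2) (Li2 w).
Proof.
intros Hw. unfold Li2. destruct (Rle_dec (Cmod w) 1) as [_ | h]; [|contradiction].
assert (B : forall k, (Cmod (w ^ S k / INR (S k) ^ 2) <= / INR (S k) ^ 2)%R).
{ intros k.
  assert (N : (0 < INR (S k))%R) by (apply lt_0_INR; lia).
  assert (NC : RtoC (INR (S k)) <> 0) by (intros e; apply RtoC_inj in e; lra).
  rewrite Cmod_div by (apply Cpow_nz; exact NC).
  rewrite !Cmod_pow, Cmod_R, Rabs_pos_eq by lra.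
  assert (P : (0 < / INR (S k) ^ 2)%R) by (apply Rinv_0_lt_compat; nra).
  assert (Q : (Cmod w ^ S k <= 1)%R).
  { rewrite <- (pow1 (S k)). apply pow_incr. split; [apply Cmod_ge_0 | exact Hw]. }
  unfold Rdiv. nra. }
apply is_series_C. split; apply Series_correct;
  apply (ex_series_le (K := R_AbsRing) (V := R_CompleteNormedModule)) with (2 := ex_series_inv_sqr);
  intros k; apply Rle_trans with (2 := B k).
- apply re_le_Cmod.
- apply Rle_trans with (2 := Rmax_Cmod _). apply Rmax_r.
Qed.

Lemma Li2_ray (w l : C) : cutplane w ->
  is_RInt (V := C_R_NormedModule) (ray w) 0 1 l -> Li2 w = - l.
Proof.
intros Hc Hl. destruct (Rle_dec (Cmod w) 1) as [h | h].
- assert (S1 := proj1 (is_series_C _ _) (ray_series w l Hc h Hl)).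
  assert (S2 := proj1 (is_series_C _ _) (Li2_series w h)).
  apply injective_projections.
  + exact (eq_trans (eq_sym (is_series_unique _ _ (proj1 S2))) (is_series_unique _ _ (proj1 S1))).
  + exact (eq_trans (eq_sym (is_series_unique _ _ (proj2 S2))) (is_series_unique _ _ (proj2 S1))).
- unfold Li2. destruct (Rle_dec (Cmod w) 1) as [h' | _]; [contradiction|].
  f_equal. apply (is_RInt_unique (V := C_R_CompleteNormedModule)).
  apply is_RInt_ext with (2 := Hl). rewrite Rmin_left, Rmax_right by lra.
  intros t Ht. unfold ray. destruct (Req_dec_T t 0) as [e | e]; [lra | reflexivity].
Qed.

Lemma Li2_holomorphic (w : C) : ~ (Im w = 0%R /\ (1 <= Re w)%R) ->
  ex_derive (K := C_AbsRing) (V := C_NormedModule) Li2 w.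
Proof.
intros Hc. destruct (cutplane_dist w Hc) as [d [Hd H]].
destruct (cutplane_RInt w Hc) as [l Hl].
destruct (cont_ex_RInt (fun t => / (1 - t * w))) as [j Hj].
{ intros t Ht. apply cont_inv. apply (slit_of_dist w d); assumption. }
exists j. split; [apply (is_linear_scal_l (K := C_AbsRing) (V := C_NormedModule))|].
intros x Hx. apply (is_filter_lim_locally_unique (K := C_AbsRing) (V := AbsRing_NormedModule C_AbsRing)) in Hx. subst x.
intros eps.
assert (Kp : (0 < 8 / d ^ 2)%R) by (apply Rdiv_lt_0_compat; nra).
assert (Hr : (0 < Rmin (d / 2) (eps / (8 / d ^ 2)))%R).
{ apply Rmin_case; [lra|]. apply Rdiv_lt_0_compat; [apply cond_pos | exact Kp]. }
apply (locally_le_locally_norm (K := C_AbsRing) (V := AbsRing_NormedModule C_AbsRing)).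
exists (mkposreal _ Hr). intros v Hv.
change (Cmod (v - w) < Rmin (d / 2) (eps / (8 / d ^ 2)))%R in Hv.
assert (Hv1 : (Cmod (v - w) <= d / 2)%R) by (apply Rlt_le, Rlt_le_trans with (1 := Hv), Rmin_l).
assert (Hv2 : (Cmod (v - w) < eps / (8 / d ^ 2))%R) by (apply Rlt_le_trans with (1 := Hv), Rmin_r).
assert (Hcv : cutplane v).
{ apply (cutplane_of_dist v (d / 2)); [lra|]. apply (dist_near w); assumption. }
destruct (cutplane_RInt v Hcv) as [lv Hlv].
rewrite (Li2_ray w l Hc Hl), (Li2_ray v lv Hcv Hlv).
assert (A := is_RInt_plus _ _ _ _ _ _ (is_RInt_minus _ _ _ _ _ _ Hlv Hl) (is_RInt_Cmult _ (v - w) _ Hj)).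
assert (P := is_RInt_const (V := R_NormedModule) 0 1 (8 / d ^ 2 * Cmod (v - w) ^ 2)%R).
assert (B := norm_RInt_le _ _ 0 1 _ _ Rle_0_1
     (fun t Ht => Rle_trans _ _ _ (Req_le _ _ (norm_C_R _)) (ray_estimate w v d Hd H Hv1 t Ht)) A P).
rewrite norm_C_R in B.
change (scal (1 - 0)%R (8 / d ^ 2 * Cmod (v - w) ^ 2)%R) with ((1 - 0) * (8 / d ^ 2 * Cmod (v - w) ^ 2))%R in B.
change (Cmod (lv - l + (v - w) * j) <= (1 - 0) * (8 / d ^ 2 * Cmod (v - w) ^ 2))%R in B.
change (Cmod ((- lv - - l) - (v - w) * j) <= eps * Cmod (v - w))%R.
replace ((- lv - - l) - (v - w) * j) with (- (lv - l + (v - w) * j)) by ring.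
rewrite Cmod_opp. apply Rle_trans with (1 := B).
assert (Hp := Cmod_ge_0 (v - w)).
assert (8 / d ^ 2 * Cmod (v - w) <= eps)%R.
{ apply Rlt_le. apply Rmult_lt_reg_r with (/ (8 / d ^ 2))%R; [apply Rinv_0_lt_compat; exact Kp|].
  replace (8 / d ^ 2 * Cmod (v - w) * / (8 / d ^ 2))%R with (Cmod (v - w)) by (field; lra).
  exact Hv2. }
nra.
Qed.

(* Main.v *)
(** Write u = x (1 - x)^2.  Since 1 / ((3k+1) binom(3k,k)) is the Beta integral of u^k over
    [0, 1] and inserting ln (1 - x) - ln x under the integral multiplies it by H_2k - H_k,
    summing binom(k,m) (u/z)^k under the integral turns the series into
      (-1)^(m+1) int_0^1 (ln (1 - x) - ln x) u^m / (u - z)^(m+1) dx.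
    The numbers a_r(z_l) are the coefficients of the partial fraction decomposition of
    u^m / (u - z)^(m+1), and C_r(l) = int_0^1 ln x / (x - l)^(r+1) dx. *)
Require Import Defs.
From Stdlib Require Import Reals.
From Coquelicot Require Import Coquelicot.
From Stdlib Require Import Factorial Lra Lia.
Open Scope C_scope.

(** The two terms [C_fun j l] and [C_fun j (1 - l)] come from the two logarithms. The substitution x
    -> 1 - x turns ln (1 - x) into ln x and a pole at z_l into a pole at 1 - z_l, with a sign
    (-1)^(r+1); so ln x is the only weight ever integrated against. H_2k - H_k appears as the
    difference of two Beta moments in which a common H_(3k+1) cancels.

    Summation under the integral is quantitative. On [0, 1] one has 0 <= u <= 1/4, hence |u / z| <=
    1/4, and binom(k,m) <= 2^k leaves a tail of size (1/2)^n uniformly in x; integrating against ln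
    x costs only the factor int_0^1 |ln x| dx = 1. The same inequality u <= 1/4 < |z| keeps z_l and
    1 - z_l off [0, 1], so that no pole integral is singular and no principal branch is crossed.

    The a_r are never computed. A partial fraction decomposition is shown to exist; multiplied by (x
    - z_l)^(m+1), it has the coefficients of its polar part at z_l as its first Taylor coefficients
    there, and these are what the derivatives in a_r read off. *)

Local Notation csum f n :=
  (sum_n (G := AbelianGroup.AbelianMonoid C_AbelianGroup) (f : nat -> C) n : C).
Local Notation is_Cderive f x l :=
  (is_derive (K := C_AbsRing) (V := C_NormedModule) (f : C -> C) (x : C) (l : C)).
Local Notation near := (locally (T := AbsRing_UniformSpace C_AbsRing)).
Local Notation is_CInt f l := (is_RInt (V := C_R_NormedModule) (f : R -> C) 0 1 (l : C)).

(** * Taylor coefficients of complex functions *)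

(* [t i] is the i-th Taylor coefficient of [f] at [a]. *)
Definition taylor (a : C) (f : C -> C) (t : nat -> C) : Prop :=
  exists F : nat -> C -> C,
    (forall x, F O x = f x) /\
    (forall i, near a (fun x => is_Cderive (F i) x (F (S i) x))) /\
    (forall i, F i a = INR (fact i) * t i).

Lemma is_Cderive_eq (f : C -> C) (x l l' : C) :
  is_Cderive f x l -> l = l' -> is_Cderive f x l'.
Proof. intros H <-. exact H. Qed.

Lemma taylor_ext (a : C) (f g : C -> C) (t u : nat -> C) :
  (forall x, f x = g x) -> (forall i, t i = u i) -> taylor a f t -> taylor a g u.
Proof.
intros E1 E2 (F & F0 & F1 & F2). exists F. repeat split.
- intros x. rewrite F0. apply E1.
- exact F1.
- intros i. rewrite F2, E2. reflexivity.
Qed.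

Lemma taylor_plus (a : C) (f g : C -> C) (t u : nat -> C) :
  taylor a f t -> taylor a g u -> taylor a (fun x => f x + g x) (fun i => t i + u i).
Proof.
intros (F & F0 & F1 & F2) (G & G0 & G1 & G2). exists (fun i x => F i x + G i x). repeat split.
- intros x. rewrite F0, G0. reflexivity.
- intros i. generalize (filter_and _ _ (F1 i) (G1 i)). apply filter_imp. intros x [h1 h2].
  exact (is_derive_plus _ _ x _ _ h1 h2).
- intros i. rewrite F2, G2. ring.
Qed.

(* The module [C_NormedModule] carries the product topology, but only its norm
   matters in [is_derive]. *)
Lemma is_Cderive_AbsRing (f : C -> C) (x l : C) :
  is_Cderive f x l <->
  is_derive (K := C_AbsRing) (V := AbsRing_NormedModule C_AbsRing) f x l.
Proof. split; intros [_ D]; split; try exact D; apply is_linear_scal_l. Qed.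

Lemma is_Cderive_const (c x : C) : is_Cderive (fun _ => c) x (RtoC 0).
Proof. exact (is_derive_const (K := C_AbsRing) (V := C_NormedModule) c x). Qed.

Lemma is_Cderive_mult (f g : C -> C) (x df dg : C) :
  is_Cderive f x df -> is_Cderive g x dg ->
  is_Cderive (fun y => f y * g y) x (df * g x + f x * dg).
Proof.
intros H1 H2.
apply is_Cderive_AbsRing. apply is_Cderive_AbsRing in H1, H2.
exact (is_derive_mult (K := C_AbsRing) f g x df dg H1 H2 Cmult_comm).
Qed.

Lemma is_Cderive_sub (a x : C) : is_Cderive (fun y => y - a) x (RtoC 1).
Proof.
apply is_Cderive_AbsRing.
replace (RtoC 1) with (minus (G := C_AbelianGroup) (RtoC 1) (RtoC 0)).
- exact (is_derive_minus (K := C_AbsRing) _ _ x _ _ (is_derive_id x)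
  (is_derive_const (V := AbsRing_NormedModule C_AbsRing) a x)).
- unfold minus, plus, opp. simpl. as_C. ring.
Qed.

Lemma taylor_const (a c : C) :
  taylor a (fun _ => c) (fun i => match i with O => c | S _ => 0 end).
Proof.
exists (fun i _ => match i with O => c | S _ => 0 end). repeat split.
- intros i. apply filter_forall. intros x.
  apply is_Cderive_const.
- intros [|i]; [simpl|]; ring.
Qed.

Lemma taylor_scal (a c : C) (f : C -> C) (t : nat -> C) :
  taylor a f t -> taylor a (fun x => c * f x) (fun i => c * t i).
Proof.
intros (F & F0 & F1 & F2). exists (fun i x => c * F i x). repeat split.
- intros x. rewrite F0. reflexivity.
- intros i. generalize (F1 i). apply filter_imp. intros x h.
  apply is_Cderive_eq with (0 * F i x + c * F (S i) x); [|ring].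
  apply (is_Cderive_mult (fun _ => c)); [|exact h].
  apply is_Cderive_const.
- intros i. rewrite F2. ring.
Qed.

Lemma taylor_shift (a : C) (f : C -> C) (t : nat -> C) :
  taylor a f t ->
  taylor a (fun x => (x - a) * f x) (fun i => match i with O => 0 | S j => t j end).
Proof.
intros (F & F0 & F1 & F2).
(* Leibniz: the i-th derivative of (x - a) f is (x - a) f^(i) + i f^(i-1). *)
exists (fun i x => (x - a) * F i x + match i with O => 0 | S j => INR i * F j x end).
repeat split.
- intros x. rewrite F0. ring.
- intros i.
  assert (H : near a (fun x => is_Cderive (F i) x (F (S i) x) /\
      match i with O => True | S j => is_Cderive (F j) x (F (S j) x) end)).
  { apply filter_and; [apply F1|]. destruct i; [apply filter_forall; trivial | apply F1]. }
  revert H. apply filter_imp. intros x [h1 h2].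
  assert (h := is_Cderive_mult _ _ _ _ _ (is_Cderive_sub a x) h1).
  assert (k : is_Cderive (fun x => match i with O => 0 | S j => INR i * F j x end) x
     (INR i * F i x)).
  { destruct i as [|j].
    - apply is_Cderive_eq with (RtoC 0); [|simpl; ring].
      apply is_Cderive_const.
    - apply is_Cderive_eq with (0 * F j x + INR (S j) * F (S j) x); [|ring].
      apply (is_Cderive_mult (fun _ => RtoC (INR (S j)))); [|exact h2].
      apply is_Cderive_const. }
  apply (is_Cderive_eq _ _ _ _ (is_derive_plus _ _ x _ _ h k)).
  rewrite S_INR, RtoC_plus.
  change (1 * F i x + (x - a) * F (S i) x + INR i * F i x =
    (x - a) * F (S i) x + (INR i + 1) * F i x). ring.
- intros [|j]; [ring|]. rewrite !F2, fact_simpl, mult_INR, RtoC_mult. ring.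
Qed.

Lemma taylor_mult_pow (a : C) (k : nat) (f : C -> C) (t : nat -> C) :
  taylor a f t ->
  taylor a (fun x => (x - a) ^ k * f x)
    (fun i => if (i <? k)%nat then 0 else t (i - k)%nat).
Proof.
intros H. induction k as [|k IH].
- apply taylor_ext with (3 := H).
  + intros x. simpl. ring.
  + intros i. rewrite Nat.sub_0_r. reflexivity.
- apply taylor_ext with (3 := taylor_shift _ _ _ IH).
  + intros x. rewrite Cpow_S. ring.
  + intros [|i]; reflexivity.
Qed.

Lemma near_neq (a b : C) : a <> b -> near a (fun x => x <> b).
Proof.
intros H. assert (P : (0 < Cmod (b - a))%R).
{ apply Cmod_gt_0. intros E. apply H. replace b with (b - a + a) by ring. rewrite E. ring. }
exists (mkposreal _ P). intros x Hx ->.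
change (Cmod (b - a) < Cmod (b - a))%R in Hx. lra.
Qed.

Lemma Csub_nz (x y : C) : x <> y -> x - y <> 0.
Proof. intros H E. apply H. replace x with (x - y + y) by ring. rewrite E. ring. Qed.

Lemma is_Cderive_inv_pow (b x : C) (n : nat) : x <> b ->
  is_Cderive (fun y => / (y - b) ^ n) x (- INR n * / (x - b) ^ S n).
Proof.
intros H. assert (N := Csub_nz _ _ H).
assert (I : is_Cderive (fun y => / (y - b)) x (- (/ (x - b) ^ 2))).
{ split; [apply (is_linear_scal_l (K := C_AbsRing) (V := C_NormedModule))|].
  intros y Hy.
  apply (is_filter_lim_locally_unique (K := C_AbsRing) (V := AbsRing_NormedModule C_AbsRing)) in Hy.
  subst y. intros eps.
  assert (P : (0 < Cmod (x - b))%R) by (apply Cmod_gt_0; exact N).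
  set (d := Cmod (x - b)) in *.
  (* The error of the linear approximation is exactly (v - x)^2 / ((v - b) (x - b)^2). The radius d
     / 2 gives |v - b| >= d / 2, and eps d^3 / 2 then makes the error at most eps |v - x|. *)
  assert (Hr : (0 < Rmin (d / 2) (eps * d ^ 3 / 2))%R).
  { assert (He := cond_pos eps). assert (0 < d ^ 3)%R by (apply pow_lt; exact P).
    apply Rmin_case; [lra|]. nra. }
  apply (locally_le_locally_norm (K := C_AbsRing) (V := AbsRing_NormedModule C_AbsRing)).
  exists (mkposreal _ Hr). intros v Hv.
  change (Cmod (v - x) < Rmin (d / 2) (eps * d ^ 3 / 2))%R in Hv.
  change (Cmod (/ (v - b) - / (x - b) - (v - x) * - / (x - b) ^ 2) <= eps * Cmod (v - x))%R.
  assert (Hv1 : (Cmod (v - x) < d / 2)%R) by (apply Rlt_le_trans with (1 := Hv), Rmin_l).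
  assert (Hv2 : (Cmod (v - x) < eps * d ^ 3 / 2)%R) by (apply Rlt_le_trans with (1 := Hv), Rmin_r).
  assert (Q : (d / 2 <= Cmod (v - b))%R).
  { assert (T := Cmod_triangle (v - b) (x - v)).
    replace (v - b + (x - v)) with (x - b) in T by ring. fold d in T.
    replace (x - v) with (- (v - x)) in T by ring. rewrite Cmod_opp in T. lra. }
  assert (Nv : v - b <> 0) by (apply Cmod_gt_0; lra).
  replace (/ (v - b) - / (x - b) - (v - x) * - / (x - b) ^ 2)
    with ((v - x) * ((v - x) / ((v - b) * (x - b) ^ 2))) by (field; split; assumption).
  assert (Nd : (v - b) * (x - b) ^ 2 <> 0) by (apply Cmult_neq_0; [exact Nv | apply Cpow_nz, N]).
  rewrite Cmod_mult, Cmod_div, Cmod_mult, Cmod_pow by exact Nd. fold d.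
  rewrite Rmult_comm. apply Rmult_le_compat_r; [apply Cmod_ge_0|].
  assert (Hd : (0 < Cmod (v - b) * d ^ 2)%R) by (apply Rmult_lt_0_compat; [lra | apply pow_lt, P]).
  apply Rmult_le_reg_r with (1 := Hd). unfold Rdiv. rewrite Rmult_assoc, Rinv_l by lra.
  assert (He := cond_pos eps).
  assert (eps * d ^ 2 * (d / 2) <= eps * d ^ 2 * Cmod (v - b))%R.
  { apply Rmult_le_compat_l; [|exact Q]. assert (0 < d ^ 2)%R by (apply pow_lt, P). nra. }
  simpl in *. lra. }
induction n as [|n IH].
- apply is_Cderive_eq with (RtoC 0); [|simpl; ring].
  apply is_derive_ext with (fun _ => RtoC 1); [intros t; simpl; as_C; field; intro E; apply RtoC_inj in E; lra|].
  apply is_Cderive_const.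
- apply is_derive_ext_loc with (fun y => / (y - b) * / (y - b) ^ n).
  { generalize (near_neq x b H). apply filter_imp. intros y hy. as_C.
    rewrite Cpow_S. field. split; [apply Cpow_nz|]; apply Csub_nz; exact hy. }
  apply (is_Cderive_eq _ _ _ _ (is_Cderive_mult _ _ _ _ _ I IH)).
  rewrite S_INR, RtoC_plus, !Cpow_S. 
  field. split; [apply Cpow_nz|]; exact N.
Qed.

Lemma taylor_inv_pow (a b : C) (n : nat) : a <> b ->
  exists t, taylor a (fun x => / (x - b) ^ n) t.
Proof.
intros H.
(* [c i] is (-1)^i n (n + 1) ... (n + i - 1), the constant of the i-th derivative c_i / (x -
   b)^(n+i). *)
set (c := fix c (i : nat) : C := match i with O => 1 | S j => - INR (n + j) * c j end).
exists (fun i => c i * / (a - b) ^ (n + i) / INR (fact i)).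
exists (fun i x => c i * / (x - b) ^ (n + i)). repeat split.
- intros x. rewrite Nat.add_0_r. simpl. ring.
- intros i. generalize (near_neq a b H). apply filter_imp. intros x hx.
  assert (D := is_Cderive_inv_pow b x (n + i) hx).
  apply is_Cderive_eq with (0 * / (x - b) ^ (n + i) + c i * (- INR (n + i) * / (x - b) ^ S (n + i))).
  + apply (is_Cderive_mult (fun _ => c i) (fun y => / (y - b) ^ (n + i))); [|exact D].
    apply is_Cderive_const.
  + rewrite Nat.add_succ_r. simpl c. ring.
- intros i. field. split.
  + apply Cpow_nz, Csub_nz, H.
  + intros E. apply RtoC_inj in E. exact (INR_fact_neq_0 i E).
Qed.

Lemma taylor_sum (a : C) (f : nat -> C -> C) (t : nat -> nat -> C) (n : nat) :
  (forall k, taylor a (f k) (t k)) ->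
  taylor a (fun x => csum (fun k => f k x) n) (fun i => csum (fun k => t k i) n).
Proof.
intros H. induction n as [|n IH].
- apply taylor_ext with (3 := H O); intros; rewrite sum_O; reflexivity.
- apply taylor_ext with (3 := taylor_plus _ _ _ _ _ IH (H (S n))); intros; rewrite sum_Sn; reflexivity.
Qed.

Lemma taylor_derive_n (a : C) (f g : C -> C) (t : nat -> C) (n : nat) :
  taylor a g t -> near a (fun x => g x = f x) ->
  C_derive_n f n a = INR (fact n) * t n.
Proof.
intros (F & F0 & F1 & F2) E. rewrite <- F2.
(* The induction carries equality on a neighbourhood, because [C_derive] at a point depends on the
   values around it. *)
assert (H : near a (fun x => F n x = C_derive_n f n x)).
{ induction n as [|n IH].
  - revert E. apply filter_imp. intros x h. simpl. rewrite F0. exact h.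
  - generalize (filter_and _ _ (locally_locally _ _ IH) (F1 n)). apply filter_imp.
    intros x [h1 h2]. simpl. symmetry. apply is_C_derive_unique.
    exact (is_derive_ext_loc _ _ x _ h1 h2). }
symmetry. exact (locally_singleton _ _ H).
Qed.

Lemma taylor_C_lim (a : C) (f g : C -> C) (t : nat -> C) :
  taylor a g t -> near a (fun x => x <> a -> g x = f x) -> C_lim f a = g a.
Proof.
intros (F & F0 & F1 & _) E. apply is_C_lim_unique.
assert (D : is_Cderive g a (F 1%nat a)).
{ apply is_derive_ext with (1 := F0). exact (locally_singleton _ _ (F1 O)). }
assert (K := ex_derive_continuous (K := C_AbsRing) (V := C_NormedModule) g a (ex_intro _ _ D)).
intros P HP. specialize (K P).
assert (HP' : near a (fun x => P (g x))).
{ apply K. exact HP. }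
apply (proj2 (locally_C a _)).
generalize (filter_and _ _ E HP'). apply filter_imp.
intros x [h1 h2] hx. rewrite <- h1; assumption.
Qed.

(** The value that [removable] inserts at a is the limit, and this is g a by continuity of g; so the
    extension agrees with g on a full neighbourhood, not only on a punctured one. *)
Lemma taylor_removable (a : C) (f g : C -> C) (t : nat -> C) (n : nat) :
  taylor a g t -> near a (fun x => x <> a -> g x = f x) ->
  C_derive_n (removable f a) n a = INR (fact n) * t n.
Proof.
intros T E. assert (L := taylor_C_lim _ _ _ _ T E).
apply taylor_derive_n with (1 := T). revert E. apply filter_imp.
intros x h. unfold removable. destruct (Ceq_dec x a) as [-> | e].
- symmetry. exact L.
- exact (h e).
Qed.

(** * Partial fractions *)

Lemma csum_plus (a b : nat -> C) (n : nat) :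
  csum (fun k => a k + b k) n = csum a n + csum b n.
Proof. exact (sum_n_plus (G := C_AbelianGroup) a b n). Qed.

Lemma csum_delta (a : nat -> C) (j n : nat) :
  csum (fun r => if Nat.eqb r j then a r else 0) n = if Nat.leb j n then a j else 0.
Proof.
induction n as [|n IH].
- rewrite sum_O. destruct j; reflexivity.
- rewrite sum_Sn, IH. change plus with Cplus.
  destruct (Nat.eqb_spec (S n) j) as [<- | e].
  + rewrite (proj2 (Nat.leb_gt (S n) n)), Nat.leb_refl by lia. as_C. ring.
  + destruct (Nat.leb_spec j n).
    * rewrite (proj2 (Nat.leb_le j (S n))) by lia. as_C. ring.
    * rewrite (proj2 (Nat.leb_gt j (S n))) by lia. as_C. ring.
Qed.

Definition principal (m : nat) (l : C) (A : nat -> C) (x : C) : C :=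
  csum (fun r => A r / (x - l) ^ S r) m.

(** A single family [A], indexed by the pole, serves all three roots, so that sums and multiples act
    on it pointwise. A lone pole is placed in it by a test of equality, which is where the roots
    have to be distinct. *)
Definition pfrac (z1 z2 z3 : C) (m : nat) (f : C -> C) : Prop :=
  exists A : C -> nat -> C, forall x, x <> z1 -> x <> z2 -> x <> z3 ->
    f x = principal m z1 (A z1) x + principal m z2 (A z2) x + principal m z3 (A z3) x.

Lemma principal_plus (m : nat) (l : C) (A B : nat -> C) (x : C) :
  principal m l (fun r => A r + B r) x = principal m l A x + principal m l B x.
Proof.
unfold principal. rewrite <- csum_plus. apply sum_n_ext. intros r. unfold Cdiv. as_C. ring.
Qed.

Lemma principal_scal (m : nat) (l c : C) (A : nat -> C) (x : C) :
  principal m l (fun r => c * A r) x = c * principal m l A x.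
Proof.
unfold principal. rewrite <- sum_n_Cmult. apply sum_n_ext. intros r. unfold Cdiv. as_C. ring.
Qed.

Lemma principal_delta (m : nat) (l l0 : C) (r0 : nat) (x : C) : (r0 <= m)%nat ->
  principal m l (fun r => if Ceq_dec l l0 then if Nat.eqb r r0 then 1 else 0 else 0) x
  = if Ceq_dec l l0 then / (x - l) ^ S r0 else 0.
Proof.
intros H. unfold principal. destruct (Ceq_dec l l0) as [_ | e].
- transitivity (csum (fun r => if Nat.eqb r r0 then / (x - l) ^ S r else 0) m).
  + apply sum_n_ext. intros r. as_C. destruct (Nat.eqb r r0); unfold Cdiv; ring.
  + rewrite csum_delta, (proj2 (Nat.leb_le r0 m)) by exact H. reflexivity.
- transitivity (0 * principal m l (fun _ => 1) x); [|ring].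
  rewrite <- principal_scal. unfold principal. apply sum_n_ext. intros r. unfold Cdiv. as_C. ring.
Qed.

Lemma pfrac_ext (z1 z2 z3 : C) (m : nat) (f g : C -> C) :
  (forall x, x <> z1 -> x <> z2 -> x <> z3 -> f x = g x) ->
  pfrac z1 z2 z3 m f -> pfrac z1 z2 z3 m g.
Proof.
intros E (A & H). exists A. intros x h1 h2 h3. rewrite <- E by assumption. apply H; assumption.
Qed.

Lemma pfrac_plus (z1 z2 z3 : C) (m : nat) (f g : C -> C) :
  pfrac z1 z2 z3 m f -> pfrac z1 z2 z3 m g -> pfrac z1 z2 z3 m (fun x => f x + g x).
Proof.
intros (A & HA) (B & HB). exists (fun l r => A l r + B l r). intros x h1 h2 h3.
rewrite !principal_plus, HA, HB by assumption. ring.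
Qed.

Lemma pfrac_scal (z1 z2 z3 c : C) (m : nat) (f : C -> C) :
  pfrac z1 z2 z3 m f -> pfrac z1 z2 z3 m (fun x => c * f x).
Proof.
intros (A & HA). exists (fun l r => c * A l r). intros x h1 h2 h3.
rewrite !principal_scal, HA by assumption. ring.
Qed.

Lemma pfrac_sum (z1 z2 z3 : C) (m n : nat) (f : nat -> C -> C) :
  (forall k, (k <= n)%nat -> pfrac z1 z2 z3 m (f k)) ->
  pfrac z1 z2 z3 m (fun x => csum (fun k => f k x) n).
Proof.
induction n as [|n IH]; intros H.
- apply pfrac_ext with (2 := H O (le_n 0)). intros x _ _ _. rewrite sum_O. reflexivity.
- apply pfrac_ext with
    (2 := pfrac_plus _ _ _ _ _ _ (IH (fun k h => H k (le_S _ _ h))) (H (S n) (le_n _))).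
  intros x _ _ _. rewrite sum_Sn. reflexivity.
Qed.

Lemma pfrac_pole (z1 z2 z3 l : C) (m r : nat) :
  z1 <> z2 -> z1 <> z3 -> z2 <> z3 -> l = z1 \/ l = z2 \/ l = z3 -> (r <= m)%nat ->
  pfrac z1 z2 z3 m (fun x => / (x - l) ^ S r).
Proof.
intros h12 h13 h23 Hl Hr.
exists (fun l' r' => if Ceq_dec l' l then if Nat.eqb r' r then RtoC 1 else RtoC 0 else RtoC 0).
intros x _ _ _. cbv beta. rewrite !principal_delta by exact Hr.
destruct (Ceq_dec z1 l) as [e1 | e1], (Ceq_dec z2 l) as [e2 | e2], (Ceq_dec z3 l) as [e3 | e3];
  try congruence; try (rewrite e1 || rewrite e2 || rewrite e3; ring).
exfalso. destruct Hl as [h | [h | h]]; congruence.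
Qed.

(** If l = l' the order of the pole rises by one, whence [S m]. Otherwise 1 / ((x-l)^(s+1) (x-l')) =
    (1 / (x-l)^(s+1) - 1 / ((x-l)^s (x-l'))) / (l - l') lowers the order at l step by step until
    only the simple pole at l' is left. *)
Lemma pfrac_pole_mult (z1 z2 z3 l l' : C) (m r : nat) :
  z1 <> z2 -> z1 <> z3 -> z2 <> z3 ->
  l = z1 \/ l = z2 \/ l = z3 -> l' = z1 \/ l' = z2 \/ l' = z3 -> (r <= m)%nat ->
  pfrac z1 z2 z3 (S m) (fun x => / (x - l) ^ S r * / (x - l')).
Proof.
intros h12 h13 h23 Hl Hl' Hr.
assert (N : forall x k, k = z1 \/ k = z2 \/ k = z3 -> x <> z1 -> x <> z2 -> x <> z3 -> x - k <> 0).
{ intros x k [-> | [-> | ->]] ? ? ?; apply Csub_nz; assumption. }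
destruct (Ceq_dec l l') as [<- | e].
- apply pfrac_ext with (fun x => / (x - l) ^ S (S r)).
  + intros x n1 n2 n3. rewrite (Cpow_S _ (S r)). field.
    repeat split; try apply Cpow_nz; apply N; assumption.
  + apply pfrac_pole; trivial. lia.
- assert (Ne := Csub_nz _ _ e).
  assert (P : pfrac z1 z2 z3 (S m) (fun x => / (x - l) ^ 0 * / (x - l'))).
  { apply pfrac_ext with (fun x => / (x - l') ^ 1).
    + intros x n1 n2 n3. simpl. field. apply N; assumption.
    + apply pfrac_pole; trivial. lia. }
  assert (G : forall s, (s <= S r)%nat -> pfrac z1 z2 z3 (S m) (fun x => / (x - l) ^ s * / (x - l'))).
  { induction s as [|s IH]; intros Hs; [exact P|].
    apply pfrac_ext with (fun x => / (l - l') * (/ (x - l) ^ S s + (-1) * (/ (x - l) ^ s * / (x - l')))).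
    + intros x n1 n2 n3. rewrite Cpow_S.
      field. repeat split; try exact Ne; try apply Cpow_nz; apply N; assumption.
    + apply pfrac_scal, pfrac_plus; [apply pfrac_pole; trivial; lia|].
      apply pfrac_scal, IH. lia. }
  apply G. lia.
Qed.

Lemma pfrac_mult (z1 z2 z3 l : C) (m : nat) (f : C -> C) :
  z1 <> z2 -> z1 <> z3 -> z2 <> z3 -> l = z1 \/ l = z2 \/ l = z3 ->
  pfrac z1 z2 z3 m f -> pfrac z1 z2 z3 (S m) (fun x => f x * / (x - l)).
Proof.
intros h12 h13 h23 Hl (A & H).
assert (P : forall l0, l0 = z1 \/ l0 = z2 \/ l0 = z3 ->
  pfrac z1 z2 z3 (S m) (fun x => principal m l0 (A l0) x * / (x - l))).
{ intros l0 H0.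
  apply pfrac_ext with (fun x => csum (fun r => A l0 r * (/ (x - l0) ^ S r * / (x - l))) m).
  - intros x _ _ _. unfold principal. rewrite (Cmult_comm (sum_n _ _)), <- sum_n_Cmult.
    apply sum_n_ext. intros r. unfold Cdiv. as_C. ring.
  - apply pfrac_sum. intros k hk. apply pfrac_scal, pfrac_pole_mult; assumption. }
apply pfrac_ext with (fun x => principal m z1 (A z1) x * / (x - l)
   + principal m z2 (A z2) x * / (x - l) + principal m z3 (A z3) x * / (x - l)).
- intros x n1 n2 n3. rewrite H by assumption. ring.
- apply pfrac_plus; [apply pfrac_plus|]; apply P; auto.
Qed.

Lemma pfrac_weaken (z1 z2 z3 : C) (m : nat) (f : C -> C) :
  z1 <> z2 -> z1 <> z3 -> z2 <> z3 ->
  pfrac z1 z2 z3 m f -> pfrac z1 z2 z3 (S m) f.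
Proof.
intros h12 h13 h23 (A & H).
apply pfrac_ext with (fun x => principal m z1 (A z1) x + principal m z2 (A z2) x
  + principal m z3 (A z3) x).
- intros x n1 n2 n3. symmetry. apply H; assumption.
- apply pfrac_plus; [apply pfrac_plus|]; apply pfrac_sum; intros k hk; apply pfrac_scal, pfrac_pole; auto.
Qed.

(* With [q = u - z], [(u / q) ^ (m + 1) = (u / q) ^ m * (1 + z / q)]. *)
Lemma pfrac_pow (z z1 z2 z3 : C) (u : C -> C) (m : nat) :
  z1 <> z2 -> z1 <> z3 -> z2 <> z3 ->
  (forall x, u x - z = (x - z1) * (x - z2) * (x - z3)) ->
  pfrac z1 z2 z3 m (fun x => u x ^ m / (u x - z) ^ S m).
Proof.
intros h12 h13 h23 Hu.
assert (n12 := Csub_nz _ _ h12). assert (n13 := Csub_nz _ _ h13). assert (n23 := Csub_nz _ _ h23).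
(* The residue at each simple root is the inverse of the product of its differences to the other
   two. *)
assert (Q : forall x, x <> z1 -> x <> z2 -> x <> z3 -> / (u x - z) =
  / ((z1 - z2) * (z1 - z3)) * / (x - z1) + - / ((z1 - z2) * (z2 - z3)) * / (x - z2)
  + / ((z1 - z3) * (z2 - z3)) * / (x - z3)).
{ intros x e1 e2 e3. rewrite Hu. field. repeat split; try assumption; apply Csub_nz; assumption. }
assert (N : forall x, x <> z1 -> x <> z2 -> x <> z3 -> u x - z <> 0).
{ intros x e1 e2 e3. rewrite Hu. repeat apply Cmult_neq_0; apply Csub_nz; assumption. }
induction m as [|m IH].
- apply pfrac_ext with (fun x => / ((z1 - z2) * (z1 - z3)) * / (x - z1) ^ 1
    + - / ((z1 - z2) * (z2 - z3)) * / (x - z2) ^ 1 + / ((z1 - z3) * (z2 - z3)) * / (x - z3) ^ 1).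
  + intros x e1 e2 e3. rewrite !Cpow_1_r, <- Q by assumption. simpl. unfold Cdiv. ring.
  + apply pfrac_plus; [apply pfrac_plus|]; apply pfrac_scal, pfrac_pole; auto.
- set (f := fun x => u x ^ m / (u x - z) ^ S m) in *.
  apply pfrac_ext with (fun x => f x +
    z * (/ ((z1 - z2) * (z1 - z3)) * (f x * / (x - z1))
     + - / ((z1 - z2) * (z2 - z3)) * (f x * / (x - z2))
     + / ((z1 - z3) * (z2 - z3)) * (f x * / (x - z3)))).
  + intros x e1 e2 e3. transitivity (f x * (1 + z * / (u x - z))).
    * rewrite Q by assumption. ring.
    * unfold f. assert (Nx := N x e1 e2 e3). rewrite !Cpow_S. field.
      repeat split; try apply Cpow_nz; exact Nx.
  + apply pfrac_plus; [apply pfrac_weaken; assumption|].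
    apply pfrac_scal, pfrac_plus; [apply pfrac_plus|]; apply pfrac_scal, pfrac_mult; auto.
Qed.

(** * The numbers a_r as coefficients of polar parts *)

(** Existence of the expansion is enough: [a_coef_principal] multiplies it by (x - a)^(m+1), which
    pushes it beyond the orders read off there. *)
Lemma taylor_principal (a l : C) (m : nat) (A : nat -> C) : a <> l ->
  exists t, taylor a (principal m l A) t.
Proof.
intros H. unfold principal. induction m as [|m [t IH]].
- destruct (taylor_inv_pow a l 1 H) as [u Hu].
  exists (fun i => A 0%nat * u i). apply taylor_ext with (3 := taylor_scal _ (A 0%nat) _ _ Hu); trivial.
  intros x. rewrite sum_O. reflexivity.
- destruct (taylor_inv_pow a l (S (S m)) H) as [u Hu].
  exists (fun i => t i + A (S m) * u i).
  apply taylor_ext with (3 := taylor_plus _ _ _ _ _ IH (taylor_scal _ (A (S m)) _ _ Hu)); trivial.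
  intros x. rewrite sum_Sn. reflexivity.
Qed.

(** Multiplication by (x - l)^(m+1) turns the polar part at l into the polynomial sum of A_k (x -
    l)^(m-k), and the other two into (x - l)^(m+1) times a function regular at l. The Taylor
    coefficient of order m - r <= m is therefore A_r. *)
Lemma a_coef_principal (m r : nat) (z : R) (l l' l'' : C) (A A' A'' : nat -> C) :
  l <> l' -> l <> l'' -> (r <= m)%nat ->
  (forall x, x <> l -> x <> l' -> x <> l'' ->
     (x * (1 - x) ^ 2) ^ m / (x * (1 - x) ^ 2 - z) ^ S m =
     principal m l A x + principal m l' A' x + principal m l'' A'' x) ->
  a_coef m z r l = A r.
Proof.
intros h1 h2 Hr H.
destruct (taylor_principal l l' m A' h1) as [t' T'].
destruct (taylor_principal l l'' m A'' h2) as [t'' T''].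
assert (T1 := taylor_sum l (fun k x => A k * ((x - l) ^ (m - k) * 1)) _ m
  (fun k => taylor_scal _ (A k) _ _ (taylor_mult_pow _ (m - k) _ _ (taylor_const l 1)))).
assert (T := taylor_plus _ _ _ _ _ T1
  (taylor_mult_pow _ (S m) _ _ (taylor_plus _ _ _ _ _ T' T''))).
unfold a_coef.
rewrite (taylor_removable l _ _ _ (m - r) T).
- assert (F : RtoC (INR (fact (m - r))) <> 0).
  { intros E. apply RtoC_inj in E. exact (INR_fact_neq_0 _ E). }
  rewrite (proj2 (Nat.ltb_lt (m - r) (S m))) by lia.
  rewrite (sum_n_ext_loc _ (fun k => if Nat.eqb k r then A k else RtoC 0) m).
  + rewrite csum_delta, (proj2 (Nat.leb_le r m)) by exact Hr. field. exact F.
  + intros k hk. as_C. destruct (Nat.eqb_spec k r) as [-> | e].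
    * rewrite Nat.ltb_irrefl, Nat.sub_diag. ring.
    * destruct (Nat.ltb_spec (m - r) (m - k)); [ring|].
      destruct (m - r - (m - k))%nat eqn:E; [lia | ring].
- generalize (filter_and _ _ (near_neq l l' h1) (near_neq l l'' h2)).
  apply filter_imp. intros x [n1 n2] n0.
  assert (N := Csub_nz _ _ n0).
  transitivity ((x - l) ^ S m * ((x * (1 - x) ^ 2) ^ m / (x * (1 - x) ^ 2 - z) ^ S m)).
  + rewrite H by assumption.
    transitivity ((x - l) ^ S m * principal m l A x
      + (x - l) ^ S m * (principal m l' A' x + principal m l'' A'' x)); [|ring].
    apply f_equal2; [|reflexivity].
    unfold principal. rewrite <- sum_n_Cmult. apply sum_n_ext_loc. intros k hk. as_C.
    replace (S m) with (m - k + S k)%nat by lia. rewrite Cpow_add_r. field.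
    apply Cpow_nz, N.
  + rewrite Cpow_mult_l, <- Cpow_mult_r, Nat.add_1_r. unfold Cdiv. ring.
Qed.

(** * The functional int_0^1 ln x f(x) dx *)

Lemma derives_cont (f : R -> C) (t : R) (l : C) : derives f t l -> cont f t.
Proof.
intros [H1 H2]. split.
- apply (ex_derive_continuous (fun s => Re (f s))). exists (Re l). exact H1.
- apply (ex_derive_continuous (fun s => Im (f s))). exists (Im l). exact H2.
Qed.

Lemma derives_ext (f g : R -> C) (t : R) (l : C) :
  (forall s, f s = g s) -> derives f t l -> derives g t l.
Proof.
intros E [H1 H2]. split.
- apply is_derive_ext with (2 := H1). intros s. rewrite E. reflexivity.
- apply is_derive_ext with (2 := H2). intros s. rewrite E. reflexivity.
Qed.

Lemma derives_eq (f : R -> C) (t : R) (l l' : C) : derives f t l -> l = l' -> derives f t l'.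
Proof. intros H <-. exact H. Qed.

Lemma derives_const (c : C) (t : R) : derives (fun _ => c) t 0.
Proof. split; exact (is_derive_const _ t). Qed.

Lemma derives_line (a b : C) (t : R) : derives (fun s => a + s * b) t b.
Proof.
apply derives_eq with (0 + b); [|ring].
apply (derives_plus (fun _ => a)); [apply derives_const|].
apply derives_eq with (RtoC (INR 1 * t ^ 0) * b); [|simpl; rewrite Rmult_1_l; ring].
apply derives_ext with (2 := derives_pow 0 b t). intros s. rewrite pow_1. reflexivity.
Qed.

Lemma derives_mult (f g : R -> C) (t : R) (a b : C) :
  derives f t a -> derives g t b -> derives (fun s => f s * g s) t (a * g t + f t * b).
Proof.
intros [F1 F2] [G1 G2].
assert (M : forall (p q : R -> R) (p' q' : R), is_derive p t p' -> is_derive q t q' ->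
  is_derive (fun s => p s * q s)%R t (p' * q t + p t * q')%R).
{ intros p q p' q' Hp Hq. exact (is_derive_mult p q t p' q' Hp Hq Rmult_comm). }
split.
- replace (Re (a * g t + f t * b)) with
    (minus (Re a * Re (g t) + Re (f t) * Re b) (Im a * Im (g t) + Im (f t) * Im b))%R.
  + apply (is_derive_ext (fun s => minus (Re (f s) * Re (g s)) (Im (f s) * Im (g s)))%R); [reflexivity|].
    apply (is_derive_minus (fun s => Re (f s) * Re (g s))%R (fun s => Im (f s) * Im (g s))%R);
      apply M; assumption.
  + unfold minus, plus, opp. destruct a, b, (f t), (g t). simpl. ring.
- replace (Im (a * g t + f t * b)) with
    (plus (Re a * Im (g t) + Re (f t) * Im b) (Im a * Re (g t) + Im (f t) * Re b))%R.
  + apply (is_derive_ext (fun s => plus (Re (f s) * Im (g s)) (Im (f s) * Re (g s)))%R); [reflexivity|].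
    apply (is_derive_plus (fun s => Re (f s) * Im (g s))%R (fun s => Im (f s) * Re (g s))%R);
      apply M; assumption.
  + unfold plus. destruct a, b, (f t), (g t). simpl. ring.
Qed.

Lemma derives_inv (f : R -> C) (t : R) (a : C) :
  f t <> 0 -> derives f t a -> derives (fun s => / f s) t (- a / (f t) ^ 2).
Proof.
intros N [F1 F2].
assert (P : (Re (f t) ^ 2 + Im (f t) ^ 2 <> 0)%R).
{ intros E. rewrite <- Cmod2_alt in E. apply Cmod_gt_0 in N. nra. }
assert (S2 : forall (p q : R -> R) (p' q' : R), is_derive p t p' -> is_derive q t q' ->
  is_derive (fun s => p s ^ 2 + q s ^ 2)%R t (2 * p' * p t + 2 * q' * q t)%R).
{ intros p q p' q' Hp Hq. auto_derive.
  - repeat split; [exists p' | exists q']; assumption.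
  - change (Derive (fun x => p x) t) with (Derive p t). change (Derive (fun x => q x) t) with (Derive q t).
    rewrite (is_derive_unique p _ _ Hp), (is_derive_unique q _ _ Hq). ring. }
assert (D := S2 _ _ _ _ F1 F2). cbv beta in D.
split.
- assert (Q := is_derive_div _ _ t _ _ F1 D P).
  match type of Q with is_derive _ _ ?v => replace (Re (- a / f t ^ 2)) with v end.
  + apply is_derive_ext with (2 := Q). intros s. reflexivity.
  + destruct a as [a1 a2], (f t) as [x y]. simpl in *. field. split; [|nra].
    contradict P. nra.
- assert (Q := is_derive_div _ _ t _ _ (is_derive_opp _ _ _ F2) D P).
  match type of Q with is_derive _ _ ?v => replace (Im (- a / f t ^ 2)) with v end.
  + apply is_derive_ext with (2 := Q). intros s. reflexivity.
  + unfold opp. destruct a as [a1 a2], (f t) as [x y]. simpl in *. field. split; [|nra].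
    contradict P. nra.
Qed.

Lemma derives_inv_pow (a b : C) (n : nat) (t : R) : a + t * b <> 0 ->
  derives (fun s => / (a + s * b) ^ n) t (- INR n * b / (a + t * b) ^ S n).
Proof.
intros N. induction n as [|n IH].
- apply derives_eq with (RtoC 0); [|simpl; unfold Cdiv; ring].
  apply derives_ext with (fun _ => / RtoC 1); [reflexivity | apply derives_const].
- apply derives_ext with (fun s => / (a + s * b) * / (a + s * b) ^ n).
  { intros s. rewrite Cpow_S.
    (* [derives_ext] asks for equality everywhere; at a zero of a + s b both sides are 0, because
       [/ 0] computes to 0. *)
    destruct (Ceq_dec (a + s * b) 0) as [-> | e].
    - rewrite Cmult_0_l. replace (/ 0) with (RtoC 0); [ring|].
      apply injective_projections; simpl; unfold Rdiv; ring.
    - field. split; [apply Cpow_nz|]; exact e. }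
  apply derives_eq with (1 := derives_mult _ _ _ _ _
    (derives_inv _ _ _ N (derives_line a b t)) IH).
  rewrite S_INR, RtoC_plus, !Cpow_S. field. split; [apply Cpow_nz|]; exact N.
Qed.

Lemma is_CInt_derives (f d : R -> C) (l : C) :
  (forall t, (0 <= t <= 1)%R -> derives f t (d t)) ->
  (forall t, (0 <= t <= 1)%R -> cont d t) ->
  f 1%R - f 0%R = l -> is_CInt d l.
Proof.
intros H1 H2 E.
assert (I := is_RInt_fct_extend_pair (U := R_NormedModule) (V := R_NormedModule) d 0 1
  (Re (f 1%R) - Re (f 0%R))%R (Im (f 1%R) - Im (f 0%R))%R).
replace l with (Re (f 1%R) - Re (f 0%R), Im (f 1%R) - Im (f 0%R))%R.
- refine (I _ _).
  + apply (is_RInt_derive (V := R_CompleteNormedModule) (fun s => Re (f s)) (fun s => Re (d s)));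
      rewrite Rmin_left, Rmax_right by lra; intros t Ht; [apply H1 | apply H2]; exact Ht.
  + apply (is_RInt_derive (V := R_CompleteNormedModule) (fun s => Im (f s)) (fun s => Im (d s)));
      rewrite Rmin_left, Rmax_right by lra; intros t Ht; [apply H1 | apply H2]; exact Ht.
Qed.

Lemma is_CInt_ext (f g : R -> C) (l : C) :
  (forall t, (0 <= t <= 1)%R -> f t = g t) -> is_CInt f l -> is_CInt g l.
Proof.
intros E. apply is_RInt_ext. rewrite Rmin_left, Rmax_right by lra.
intros t Ht. apply E. lra.
Qed.

Lemma is_CInt_const (c : C) : is_CInt (fun _ => c) c.
Proof.
apply (is_CInt_derives (fun s => 0 + s * c) (fun _ => c)).
- intros t _. apply derives_line.
- intros t _. apply derives_cont with (RtoC 0), derives_const.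
- ring.
Qed.

Lemma is_CInt_bound (f : R -> C) (l : C) (M : R) :
  (forall t, (0 <= t <= 1)%R -> (Cmod (f t) <= M)%R) -> is_CInt f l -> (Cmod l <= M)%R.
Proof.
intros H I.
assert (P := is_RInt_const (V := R_NormedModule) 0 1 M).
change (scal (1 - 0)%R M) with ((1 - 0) * M)%R in P. rewrite Rminus_0_r, Rmult_1_l in P.
rewrite <- norm_C_R.
apply (norm_RInt_le _ _ 0 1 _ _ Rle_0_1
  (fun t Ht => Rle_trans _ _ _ (Req_le _ _ (norm_C_R _)) (H t Ht)) I P).
Qed.

(* [c] is the integral of [ln x * f x] over [0, 1], which by [ln x = - int_x^1 dy / y]
   and [x = s t], [y = t] is the integral below; this avoids improper integrals. *)
Definition log_moment (f : R -> C) (c : C) : Prop :=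
  exists G : R -> C,
    (forall t, (0 <= t <= 1)%R -> is_CInt (fun s => f (s * t)%R) (G t)) /\ is_CInt G (- c).

Lemma log_moment_ext (f g : R -> C) (c : C) :
  (forall x, (0 <= x <= 1)%R -> f x = g x) -> log_moment f c -> log_moment g c.
Proof.
intros E (G & H1 & H2). exists G. split; [|exact H2]. intros t Ht.
apply is_CInt_ext with (2 := H1 t Ht). intros s Hs. apply E. nra.
Qed.

Lemma log_moment_plus (f g : R -> C) (c d : C) :
  log_moment f c -> log_moment g d -> log_moment (fun x => f x + g x) (c + d).
Proof.
intros (F & F1 & F2) (G & G1 & G2). exists (fun t => F t + G t). split.
- intros t Ht. exact (is_RInt_plus _ _ _ _ _ _ (F1 t Ht) (G1 t Ht)).
- replace (- (c + d)) with (- c + - d) by ring. exact (is_RInt_plus _ _ _ _ _ _ F2 G2).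
Qed.

Lemma log_moment_scal (f : R -> C) (k c : C) :
  log_moment f c -> log_moment (fun x => k * f x) (k * c).
Proof.
intros (F & F1 & F2). exists (fun t => k * F t). split.
- intros t Ht. exact (is_RInt_Cmult _ k _ (F1 t Ht)).
- replace (- (k * c)) with (k * - c) by ring. exact (is_RInt_Cmult _ k _ F2).
Qed.

Lemma log_moment_sum (f : nat -> R -> C) (c : nat -> C) (n : nat) :
  (forall k, log_moment (f k) (c k)) ->
  log_moment (fun x => csum (fun k => f k x) n) (csum c n).
Proof.
intros H. induction n as [|n IH].
- rewrite sum_O. apply log_moment_ext with (2 := H O). intros x _. rewrite sum_O. reflexivity.
- rewrite sum_Sn. apply log_moment_ext with (2 := log_moment_plus _ _ _ _ IH (H (S n))).
  intros x _. rewrite sum_Sn. reflexivity.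
Qed.

(** The functional has norm at most 1 for the sup norm, reflecting int_0^1 |ln x| dx = 1; in the
    double integral this is just averaging twice over an interval of length 1. *)
Lemma log_moment_bound (f : R -> C) (c : C) (M : R) :
  (forall x, (0 <= x <= 1)%R -> (Cmod (f x) <= M)%R) -> log_moment f c -> (Cmod c <= M)%R.
Proof.
intros H (G & H1 & H2). rewrite <- Cmod_opp.
apply is_CInt_bound with (2 := H2). intros t Ht.
apply is_CInt_bound with (2 := H1 t Ht). intros s Hs. apply H. nra.
Qed.

Lemma harmonic_S (n : nat) : harmonic (S n) = (harmonic n + / INR (S n))%R.
Proof. unfold harmonic. rewrite sum_n_Sm by lia. reflexivity. Qed.

(** This is the derivative of the Beta function B(a+1, b+1) in its first argument, obtained without
    differentiating in a parameter: induction on b through x^a (1-x)^(b+1) = x^a (1-x)^b - x^(a+1)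
    (1-x)^b, starting from int_0^1 x^a ln x dx = -1 / (a+1)^2. *)
Lemma log_moment_beta (a b : nat) :
  log_moment (fun x => RtoC (x ^ a * (1 - x) ^ b))
    (RtoC (INR (fact a) * INR (fact b) / INR (fact (a + b + 1)) *
      (harmonic a - harmonic (a + b + 1)))).
Proof.
revert a. induction b as [|b IH]; intros a.
- assert (N : INR (S a) <> 0%R) by (apply not_0_INR; lia).
  assert (NC : RtoC (INR (S a)) <> 0) by (intros e; apply RtoC_inj in e; exact (N e)).
  exists (fun t => RtoC (t ^ a) * (1 / INR (S a))). split.
  + intros t _.
    replace (RtoC (t ^ a) * (1 / INR (S a))) with (RtoC (t ^ a) * INR (S a) / INR (S a) ^ 2)
      by (field; exact NC).
    apply is_CInt_ext with (2 := is_RInt_pow_term (RtoC (t ^ a) * INR (S a)) a). intros s _.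
    rewrite Rpow_mult_distr, pow_O, Rmult_1_r, RtoC_mult. field. exact NC.
  + replace (a + 0 + 1)%nat with (S a) by lia. rewrite harmonic_S, fact_simpl, mult_INR. simpl (fact 0).
    match goal with |- is_RInt _ _ _ (- RtoC ?e) =>
      replace (- RtoC e) with (1 / INR (S a) ^ 2) end.
    * apply is_RInt_pow_term.
    * match goal with |- _ = - RtoC ?e => replace e with (- (1 / INR (S a) ^ 2))%R end.
      -- rewrite RtoC_opp, RtoC_div, RtoC_pow; [ring | apply pow_nonzero; exact N].
      -- change (INR 1) with 1%R. field. split; [exact N | apply INR_fact_neq_0].
- assert (H := log_moment_plus _ _ _ _ (IH a) (log_moment_scal _ (-1) _ (IH (S a)))).
  match type of H with log_moment _ ?c => replace (RtoC _) with c end.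
  + apply log_moment_ext with (2 := H). intros x _.
    rewrite <- RtoC_mult, <- RtoC_plus. f_equal. simpl. ring.
  + rewrite <- RtoC_mult, <- RtoC_plus. f_equal.
    replace (a + S b + 1)%nat with (S (a + b + 1)) by lia.
    replace (S a + b + 1)%nat with (S (a + b + 1)) by lia.
    rewrite !harmonic_S, !fact_simpl, !mult_INR.
    assert (Na : INR (S a) <> 0%R) by (apply not_0_INR; lia).
    assert (Nb : INR (S b) <> 0%R) by (apply not_0_INR; lia).
    assert (E : INR (S (a + b + 1)) = (INR (S a) + INR (S b))%R).
    { rewrite <- plus_INR. f_equal. lia. }
    assert (Ns : INR (S (a + b + 1)) <> 0%R) by (apply not_0_INR; lia).
    rewrite E in *.
    assert (Fs := INR_fact_neq_0 (a + b + 1)).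
    field. auto.
Qed.

(** * Logarithmic moments of the poles: the functions C_r *)

(** Inversion maps the cut [1, +oo[ onto ]0, 1], so a point off [0, 1] has its inverse off the cut
    of the dilogarithm. *)
Lemma cutplane_inv (l : C) : (forall t : R, (0 <= t <= 1)%R -> l <> t) -> cutplane (/ l).
Proof.
intros H [E1 E2].
assert (N : l <> 0) by (apply (H 0%R); lra).
assert (P : / l = RtoC (Re (/ l))).
{ apply injective_projections; [reflexivity | exact E1]. }
apply (H (/ Re (/ l))%R).
- split; [left; apply Rinv_0_lt_compat; lra|].
  rewrite <- Rinv_1. apply Rinv_le_contravar; lra.
- rewrite RtoC_inv, <- P by lra. field. exact N.
Qed.

Lemma is_CInt_line_inv_pow (a b : C) (n : nat) :
  (forall t : R, (0 <= t <= 1)%R -> a + t * b <> 0) -> b <> 0 ->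
  is_CInt (fun t => / (a + t * b) ^ S (S n))
    (- / (INR (S n) * b) * (/ (a + b) ^ S n - / a ^ S n)).
Proof.
intros H Hb.
assert (N : RtoC (INR (S n)) <> 0).
{ intros e. apply RtoC_inj in e. revert e. apply not_0_INR. lia. }
apply (is_CInt_derives (fun t => - / (INR (S n) * b) * / (a + t * b) ^ S n)).
- intros t Ht.
  apply derives_eq with (1 := derives_mult _ _ _ _ _ (derives_const _ t)
    (derives_inv_pow a b (S n) t (H t Ht))).
  rewrite (Cpow_S _ (S n)). assert (K := H t Ht). field. 
  repeat split; trivial. apply Cpow_nz, K.
- intros t Ht. exact (derives_cont _ _ _ (derives_inv_pow a b (S (S n)) t (H t Ht))).
- rewrite Cmult_1_l, Cmult_0_l, Cplus_0_r. ring.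
Qed.

(** The antiderivative is - ln (1 - s t / l) rather than - ln (l - s t): along the segment 1 - s t /
    l stays off the negative axis and 0, so the principal branch does not jump, and it vanishes at s
    = 0. *)
Lemma is_CInt_line_inv (l : C) (t : R) : (forall s : R, (0 <= s <= 1)%R -> l <> s) -> (0 <= t <= 1)%R ->
  is_CInt (fun s => RtoC t / (l - s * t)) (- Cln (1 - t / l)).
Proof.
intros H Ht.
assert (Nl : l <> 0) by (apply (H 0%R); lra).
assert (Hx : forall s : R, (0 <= s <= 1)%R -> slit (1 + s * - (t / l)) /\ l - s * t <> 0).
{ intros s Hs. assert (Hst : (0 <= s * t <= 1)%R) by nra. split.
  - destruct (cutplane_dist (/ l) (cutplane_inv l H)) as [d [Hd D]].
    replace (1 + s * - (t / l)) with (1 - RtoC (s * t) * / l).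
    + apply (slit_of_dist _ d); assumption.
    + rewrite RtoC_mult. unfold Cdiv. ring.
  - rewrite <- RtoC_mult. apply Csub_nz, H. exact Hst. }
apply (is_CInt_derives (fun s => (-1) * Cln (1 + s * - (t / l)))).
- intros s Hs. destruct (Hx s Hs) as [S1 S2].
  apply derives_eq with (1 := derives_mult _ _ _ _ _ (derives_const (-1) s) (derives_Cln _ _ _ S1)).
  field. split; assumption.
- intros s Hs. destruct (Hx s Hs) as [S1 S2].
  apply derives_cont with (RtoC 0 * / (l + s * - t) ^ 1 + RtoC t * (- INR 1 * - t / (l + s * - t) ^ 2)).
  apply derives_ext with (fun s : R => t * / (l + s * - t) ^ 1).
  + intros u. simpl. unfold Cdiv. rewrite Cmult_1_r. f_equal. f_equal. ring.
  + apply (derives_mult (fun _ => RtoC t)); [apply derives_const|].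
    apply derives_inv_pow. replace (l + s * - t) with (l - s * t) by ring. exact S2.
- replace (1 + 1%R * - (t / l)) with (1 - t / l) by ring.
  replace (1 + 0%R * - (t / l)) with (RtoC 1) by ring. rewrite Cln_1. ring.
Qed.

(** The inner integral of 1 / (s t - l) over s is ln (1 - t / l) / t, with value - 1 / l at t = 0.
    This is exactly [ray (/ l) t], whose integral is - Li2 (1 / l). *)
Lemma log_moment_simple_pole (l : C) : (forall s : R, (0 <= s <= 1)%R -> l <> s) ->
  log_moment (fun x => / (x - l)) (Li2 (/ l)).
Proof.
intros H. assert (Nl : l <> 0) by (apply (H 0%R); lra).
assert (Hc := cutplane_inv l H).
destruct (cutplane_RInt _ Hc) as [c Hcc].
rewrite (Li2_ray _ _ Hc Hcc).
exists (ray (/ l)). split.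
- intros t Ht. unfold ray. destruct (Req_dec_T t 0) as [-> | e].
  + apply is_CInt_ext with (2 := is_CInt_const (- / l)). intros s _.
    rewrite Rmult_0_r. field. exact Nl.
  + assert (Nt : RtoC t <> 0) by (intros E; apply RtoC_inj in E; exact (e E)).
    assert (I := is_RInt_Cmult _ (- / t) _ (is_CInt_line_inv l t H Ht)).
    replace (Cln (1 - t * / l) / t) with (- / t * - Cln (1 - t / l)) by (unfold Cdiv; ring).
    apply is_CInt_ext with (2 := I). intros s Hs.
    assert (N : l - s * t <> 0) by (rewrite <- RtoC_mult; apply Csub_nz, H; nra).
    rewrite RtoC_mult. field. repeat split; trivial.
    rewrite <- RtoC_mult. apply Csub_nz, not_eq_sym, H. nra.
- replace (- - c) with c by ring. exact Hcc.
Qed.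

Lemma Cpow_opp (x : C) (n : nat) : (- x) ^ n = (-1) ^ n * x ^ n.
Proof. rewrite <- Cpow_mult_l. f_equal. ring. Qed.

Lemma Cpow_neg1_sqr (n : nat) : (-1) ^ n * (-1) ^ n = 1.
Proof. rewrite <- Cpow_mult_l. replace (-1 * -1) with (RtoC 1) by ring. apply Cpow_1_l. Qed.

Lemma Cpow_neg1_nz (n : nat) : (-1) ^ n <> 0.
Proof. apply Cpow_nz. intros E. apply RtoC_inj in E. lra. Qed.

Lemma csum_const (c : C) (n : nat) : csum (fun _ => c) n = INR (S n) * c.
Proof.
induction n as [|n IH].
- rewrite sum_O. simpl. as_C. ring.
- rewrite sum_Sn, IH. change plus with Cplus. rewrite (S_INR (S n)), RtoC_plus. as_C. ring.
Qed.

Lemma INR_S_nz (n : nat) : RtoC (INR (S n)) <> 0.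
Proof. intros e. apply RtoC_inj in e. revert e. apply not_0_INR. lia. Qed.

(** The factorization of a^(n+1) - b^(n+1) by a - b for a = 1 / (l - t) and b = 1 / l, where a - b =
    t a b. It serves to divide the inner integral of [log_moment_pole] by t, removing its
    singularity at t = 0. *)
Lemma inv_pow_sub (l t : C) (n : nat) : l <> 0 -> l - t <> 0 ->
  t * csum (fun p => / l ^ (S n - p) * / (l - t) ^ S p) n = / (l - t) ^ S n - / l ^ S n.
Proof.
intros Hl Ht. induction n as [|n IH].
- rewrite sum_O. simpl. field. split; assumption.
- rewrite sum_Sn. change plus with Cplus.
  rewrite (sum_n_ext_loc _ (fun p => / l * (/ l ^ (S n - p) * / (l - t) ^ S p)) n).
  + rewrite sum_n_Cmult. replace (S (S n) - S n)%nat with 1%nat by lia.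
    transitivity (/ l * (t * csum (fun p => / l ^ (S n - p) * / (l - t) ^ S p) n)
      + t * (/ l ^ 1 * / (l - t) ^ S (S n))); [ring|].
    rewrite IH, !Cpow_S. simpl (l ^ 0). field.
    repeat split; trivial; apply Cpow_nz; assumption.
  + intros p hp. replace (S (S n) - p)%nat with (S (S n - p)) by lia.
    rewrite (Cpow_S l (S n - p)). as_C. field. repeat split; trivial; apply Cpow_nz; assumption.
Qed.

(** For r = n + 1 the inner integral of 1 / (s t - l)^(r+1) is a multiple of (1 / (l-t)^r - 1 / l^r)
    / t, which [inv_pow_sub] expands into the powers 1 / (l-t)^(p+1) with 0 <= p <= n. Integrated
    over t, the term p = 0 yields the logarithm in C_r and the others its rational sum. *)
Lemma log_moment_pole (l : C) (r : nat) : (forall s : R, (0 <= s <= 1)%R -> l <> s) ->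
  log_moment (fun x => / (x - l) ^ S r) (C_fun r l).
Proof.
intros H. destruct r as [|n].
{ apply log_moment_ext with (2 := log_moment_simple_pole l H). intros x _.
  rewrite Cpow_1_r. reflexivity. }
assert (Nl : l <> 0) by (apply (H 0%R); lra).
assert (Hx : forall t : R, (0 <= t <= 1)%R -> l - t <> 0) by (intros t Ht; apply Csub_nz, H, Ht).
assert (Nn := INR_S_nz n).
(* The factor -1 / r of the antiderivative, with the sign (-1)^r from rewriting (t - l)^r as (-1)^r
   (l - t)^r. *)
set (k := - ((-1) ^ S n / INR (S n))).
exists (fun t : R => k * csum (fun p => / l ^ (S n - p) * / (l - t) ^ S p) n). split.
- intros t Ht. assert (Nt := Hx t Ht).
  (* At t = 0 the antiderivative in s breaks down, the slope being 0; the integrand is then constant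
     and the n + 1 equal terms of the sum give its value. *)
  destruct (Ceq_dec t 0) as [e | e].
  + rewrite e. apply RtoC_inj in e. subst t.
    replace (csum (fun p => / l ^ (S n - p) * / (l - 0) ^ S p) n) with (INR (S n) * / l ^ S (S n)).
    * apply is_CInt_ext with (2 := is_CInt_const _). intros s _. unfold k.
      rewrite Rmult_0_r. replace (0 - l) with (- l) by ring.
      rewrite Cpow_opp. assert (E := Cpow_neg1_sqr (S (S n))). assert (Ne := Cpow_neg1_nz (S (S n))).
      replace (/ ((-1) ^ S (S n) * l ^ S (S n))) with ((-1) ^ S (S n) * / l ^ S (S n)).
      -- rewrite !(Cpow_S (-1)). assert (Nm := Cpow_nz l (S (S n)) Nl). field. split; assumption.
      -- rewrite <- (Cmult_1_l (/ (_ * _))), <- E. field. split; [apply Cpow_nz, Nl | exact Ne].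
    * rewrite <- csum_const. apply sum_n_ext_loc. intros p hp. as_C.
      replace (l - 0) with l by ring.
      replace (S (S n)) with (S n - p + S p)%nat by lia. rewrite Cpow_add_r. field.
      split; apply Cpow_nz, Nl.
  + assert (K : forall s : R, (0 <= s <= 1)%R -> - l + s * t <> 0).
    { intros s Hs. replace (- l + s * t) with (s * t - l) by ring.
      rewrite <- RtoC_mult. apply Csub_nz, not_eq_sym, H. nra. }
    assert (I := is_CInt_line_inv_pow (- l) t n K e).
    match type of I with is_RInt _ _ _ ?v => replace (k * _) with v end.
    * apply is_CInt_ext with (2 := I).
      intros s Hs. rewrite RtoC_mult. replace (- l + s * t) with (s * t - l) by ring. reflexivity.
    * unfold k.
      transitivity (- ((-1) ^ S n / INR (S n)) / t *
        (t * csum (fun p => / l ^ (S n - p) * / (l - t) ^ S p) n)); [|field; split; assumption].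
      rewrite inv_pow_sub by assumption.
      replace (- l + t) with (- (l - t)) by ring. rewrite !Cpow_opp.
      assert (E := Cpow_neg1_sqr (S n)). assert (Ne := Cpow_neg1_nz (S n)).
      set (s := (-1) ^ S n) in *.
      assert (Es : / s = s). { rewrite <- (Cmult_1_l (/ s)), <- E. field. exact Ne. }
      transitivity (- / (INR (S n) * t) * / s * (/ (l - t) ^ S n - / l ^ S n)).
      -- field. repeat split; trivial; apply Cpow_nz; assumption.
      -- rewrite Es. field. repeat split; trivial; apply Cpow_nz; assumption.
- set (I := fun p => match p with
     | O => - Cln (1 - 1%R / l)
     | S _ => / INR p * (/ (l - 1) ^ p - / l ^ p) end).
  replace (- C_fun (S n) l) with (k * csum (fun p => / l ^ (S n - p) * I p) n).
  + apply is_RInt_Cmult, is_RInt_csum. intros p. apply is_RInt_Cmult. destruct p as [|q].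
    * apply is_CInt_ext with (2 := is_CInt_line_inv l 1 H (conj Rle_0_1 (Rle_refl 1))).
      intros t Ht. rewrite Cpow_1_r, Cmult_1_r. unfold Cdiv. apply Cmult_1_l.
    * assert (K : forall t : R, (0 <= t <= 1)%R -> l + t * -1 <> 0).
      { intros t Ht. replace (l + t * -1) with (l - t) by ring. exact (Hx t Ht). }
      assert (N1 : RtoC (-1) <> 0) by (intros e; apply RtoC_inj in e; lra).
      assert (J := is_CInt_line_inv_pow l (-1) q K N1).
      match type of J with is_RInt _ _ _ ?v => replace (I (S q)) with v end.
      -- apply is_CInt_ext with (2 := J).
         intros t Ht. do 2 f_equal. ring.
      -- unfold I. assert (Nq := INR_S_nz q).
         replace (l + -1) with (l - 1) by ring.
         assert (K1 := Hx 1%R (conj Rle_0_1 (Rle_refl 1))).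
         field. repeat split; trivial; try (apply Cpow_nz; assumption).
  + unfold C_fun. unfold sum_n. rewrite sum_Sn_m by lia. change plus with Cplus.
    replace (S n - 1)%nat with n by lia.
    match goal with |- _ = - (_ * ?s - _) => set (T := s) end.
    match goal with |- k * (_ + ?s) = _ => replace s with T end.
    * unfold I, k. replace ((l - 1) / l) with (1 - 1%R / l) by (field; exact Nl).
      rewrite Nat.sub_0_r. field. repeat split; trivial. apply Cpow_nz, Nl.
    * unfold T. apply sum_n_m_ext_loc. intros p [hp1 hp2]. destruct p as [|q]; [lia|].
      unfold I. assert (Nq := INR_S_nz q).
      assert (K := Hx 1%R (conj Rle_0_1 (Rle_refl 1))). as_C.
      field. repeat split; trivial; apply Cpow_nz; assumption.
Qed.

(** * Summation of the series under the integral *)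

Lemma binom_0_r (n : nat) : binom n 0 = 1%R.
Proof.
unfold binom, Binomial.C. simpl Nat.leb. rewrite Nat.sub_0_r. simpl (fact 0).
change (INR 1) with 1%R. field. apply INR_fact_neq_0.
Qed.

Lemma binom_diag (n : nat) : binom n n = 1%R.
Proof.
unfold binom, Binomial.C. rewrite Nat.leb_refl, Nat.sub_diag. simpl (fact 0).
change (INR 1) with 1%R. field. apply INR_fact_neq_0.
Qed.

Lemma binom_gt (n k : nat) : (n < k)%nat -> binom n k = 0%R.
Proof. intros H. unfold binom. rewrite (proj2 (Nat.leb_gt k n) H). reflexivity. Qed.

Lemma binom_S_S (n k : nat) : binom (S n) (S k) = (binom n k + binom n (S k))%R.
Proof.
destruct (Nat.lt_trichotomy k n) as [h | [-> | h]].
- unfold binom. rewrite !(proj2 (Nat.leb_le _ _)) by lia. symmetry. apply pascal. exact h.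
- rewrite !binom_diag, binom_gt by lia. ring.
- rewrite !binom_gt by lia. ring.
Qed.

Lemma binom_bound (n k : nat) : (0 <= binom n k <= 2 ^ n)%R.
Proof.
revert k. induction n as [|n IH]; intros [|k].
- rewrite binom_0_r. simpl. lra.
- rewrite binom_gt by lia. simpl. lra.
- rewrite binom_0_r. assert (H := pow_R1_Rle 2 (S n)). lra.
- rewrite binom_S_S. simpl. assert (H1 := IH k). assert (H2 := IH (S k)). lra.
Qed.

(** Pascal's rule for the truncated series: passing from m to m + 1 multiplies the generating
    function t^m / (1-t)^(m+1) by t / (1-t), up to one boundary term. *)
Lemma binom_gen_partial (m n : nat) (t : R) :
  ((1 - t) * sum_n (fun k => binom k (S m) * t ^ k) n
   = t * sum_n (fun k => binom k m * t ^ k) n - binom (S n) (S m) * t ^ S n)%R.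
Proof.
induction n as [|n IH].
- rewrite !sum_O, binom_S_S, (binom_gt 0 (S m)) by lia. simpl. ring.
- rewrite !sum_Sn. change plus with Rplus. rewrite Rmult_plus_distr_l, IH, (binom_S_S (S n)).
  simpl. ring.
Qed.

(** With R_m the remainder, R_(m+1) = (t R_m + binom(n+1, m+1) t^(n+1)) / (1 - t). Since the
    binomial is at most 2^(n+1), induction on m closes with no loss: 4/3 (1/4 + 1/2) = 1. *)
Lemma binom_gen_remainder (m n : nat) (t : R) : (Rabs t <= 1 / 4)%R ->
  (Rabs (t ^ m / (1 - t) ^ S m - sum_n (fun k => binom k m * t ^ k) n) <= (1 / 2) ^ n)%R.
Proof.
intros Ht.
assert (Hb : (-1 / 4 <= t <= 1 / 4)%R).
{ apply Rabs_le_between in Ht. lra. }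
assert (Hn : (Rabs (t ^ S n) <= 1 / 4 * (1 / 4) ^ n)%R).
{ rewrite <- RPow_abs. apply (pow_incr (Rabs t) (1 / 4) (S n)). split; [apply Rabs_pos | exact Ht]. }
assert (Q : (0 < / (1 - t) <= 4 / 3)%R).
{ split; [apply Rinv_0_lt_compat; lra|].
  replace (4 / 3)%R with (/ (3 / 4))%R by field. apply Rinv_le_contravar; lra. }
assert (P2 : (0 < (1 / 2) ^ n)%R) by (apply pow_lt; lra).
induction m as [|m IH].
- replace (t ^ 0 / (1 - t) ^ 1 - sum_n (fun k => binom k 0 * t ^ k) n)%R
    with (/ (1 - t) * t ^ S n)%R.
  + rewrite Rabs_mult, (Rabs_pos_eq (/ (1 - t))) by lra.
    assert (P4 : ((1 / 4) ^ n <= (1 / 2) ^ n)%R) by (apply pow_incr; lra).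
    assert (P5 : (0 < (1 / 4) ^ n)%R) by (apply pow_lt; lra).
    assert (P6 := Rabs_pos (t ^ S n)). nra.
  + rewrite (sum_n_ext _ (fun k => t ^ k)%R) by (intros k; rewrite binom_0_r; apply Rmult_1_l).
    replace (sum_n (fun k => t ^ k)%R n) with ((1 - t ^ S n) / (1 - t))%R.
    * simpl. field. lra.
    * rewrite sum_n_Reals, tech3 by lra. reflexivity.
- assert (E := binom_gen_partial m n t).
  set (T1 := sum_n (fun k => binom k (S m) * t ^ k)%R n) in *.
  set (T0 := sum_n (fun k => binom k m * t ^ k)%R n) in *.
  replace (t ^ S m / (1 - t) ^ S (S m) - T1)%R with
    (/ (1 - t) * (t * (t ^ m / (1 - t) ^ S m - T0) + binom (S n) (S m) * t ^ S n))%R.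
  + rewrite Rabs_mult, (Rabs_pos_eq (/ (1 - t))) by lra.
    assert (B : (Rabs (binom (S n) (S m) * t ^ S n) <= 1 / 2 * (1 / 2) ^ n)%R).
    { rewrite Rabs_mult. assert (b := binom_bound (S n) (S m)). rewrite Rabs_pos_eq by lra.
      apply Rle_trans with (2 ^ S n * (1 / 4 * (1 / 4) ^ n))%R.
      - apply Rmult_le_compat; try lra. apply Rabs_pos.
      - right. replace (1 / 2)%R with (2 * (1 / 4))%R by field.
        rewrite Rpow_mult_distr. simpl. ring. }
    assert (T := Rabs_triang (t * (t ^ m / (1 - t) ^ S m - T0)) (binom (S n) (S m) * t ^ S n)).
    rewrite (Rabs_mult t) in T.
    assert (a := Rabs_pos t). assert (a' := Rabs_pos (t ^ m / (1 - t) ^ S m - T0)).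
    assert (K : (Rabs t * Rabs (t ^ m / (1 - t) ^ S m - T0) <= 1 / 4 * (1 / 2) ^ n)%R).
    { apply Rmult_le_compat; assumption. }
    set (X := Rabs (t * (t ^ m / (1 - t) ^ S m - T0) + binom (S n) (S m) * t ^ S n)) in *.
    assert (X <= 3 / 4 * (1 / 2) ^ n)%R by lra.
    assert (0 <= X)%R by apply Rabs_pos.
    nra.
  + replace T1 with (/ (1 - t) * ((1 - t) * T1))%R by (field; lra).
    rewrite E. simpl. field. split; [lra | apply pow_nonzero; lra].
Qed.

(** * The roots of the cubic and the unit interval *)

(** Vieta by divided differences: subtracting the equations of two roots and dividing by the
    difference of the roots, twice, gives z1 + z2 + z3 = 2; the factorization then follows from one
    first divided difference. *)
Lemma cubic_roots (z z1 z2 z3 : C) :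
  z1 * (1 - z1) ^ 2 - z = 0 -> z2 * (1 - z2) ^ 2 - z = 0 -> z3 * (1 - z3) ^ 2 - z = 0 ->
  z1 <> z2 -> z1 <> z3 -> z2 <> z3 ->
  forall x, x * (1 - x) ^ 2 - z = (x - z1) * (x - z2) * (x - z3).
Proof.
intros h1 h2 h3 h12 h13 h23 x.
assert (V : forall a b c : C, a <> 0 -> a * b = a * c -> b = c).
{ intros a b c Na E. replace b with (a * b / a) by (field; exact Na). rewrite E. field. exact Na. }
assert (E2 : z1 ^ 2 + z1 * z2 + z2 ^ 2 - 2 * (z1 + z2) + 1 = 0).
{ apply (V (z1 - z2)); [apply Csub_nz, h12|].
  transitivity ((z1 * (1 - z1) ^ 2 - z) - (z2 * (1 - z2) ^ 2 - z)); [ring|]. rewrite h1, h2. ring. }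
assert (E3 : z1 ^ 2 + z1 * z3 + z3 ^ 2 - 2 * (z1 + z3) + 1 = 0).
{ apply (V (z1 - z3)); [apply Csub_nz, h13|].
  transitivity ((z1 * (1 - z1) ^ 2 - z) - (z3 * (1 - z3) ^ 2 - z)); [ring|]. rewrite h1, h3. ring. }
assert (E : z3 = 2 - z1 - z2).
{ assert (S3 : z1 + z2 + z3 - 2 = 0).
  { apply (V (z2 - z3)); [apply Csub_nz, h23|].
    transitivity ((z1 ^ 2 + z1 * z2 + z2 ^ 2 - 2 * (z1 + z2) + 1)
      - (z1 ^ 2 + z1 * z3 + z3 ^ 2 - 2 * (z1 + z3) + 1)); [ring|]. rewrite E2, E3. ring. }
  transitivity (z1 + z2 + z3 - 2 + (2 - z1 - z2)); [ring|]. rewrite S3. ring. }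
rewrite E.
transitivity (x * (1 - x) ^ 2 - z1 * (1 - z1) ^ 2 + (z1 * (1 - z1) ^ 2 - z)); [ring|].
rewrite h1.
transitivity ((x - z1) * (x - z2) * (x - (2 - z1 - z2))
  + (x - z1) * (z1 ^ 2 + z1 * z2 + z2 ^ 2 - 2 * (z1 + z2) + 1)); [ring|].
rewrite E2. ring.
Qed.

(** The maximum is 4/27, at x = 1/3; the cruder 1/4 is the threshold of [binom_gen_remainder]. *)
Lemma unit_interval_bound (x : R) : (0 <= x <= 1)%R -> (0 <= x * (1 - x) ^ 2 <= 1 / 4)%R.
Proof.
intros Hx. assert (0 <= (x - 1 / 2) ^ 2)%R by apply pow2_ge_0.
assert (0 <= x * (1 - x) <= 1 / 4)%R by nra. simpl. nra.
Qed.

(** A root in [0, 1] would give |z| <= 1/4. The interval is stable under x -> 1 - x, which settles 1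
    - l as well. *)
Lemma root_off_unit_interval (z : R) (l : C) : (1 <= Rabs z)%R -> l * (1 - l) ^ 2 - z = 0 ->
  forall t : R, (0 <= t <= 1)%R -> l <> t /\ 1 - l <> t.
Proof.
intros hz hl.
assert (K : forall t : R, (0 <= t <= 1)%R -> l <> t).
{ intros t Ht ->. assert (B := unit_interval_bound t Ht).
  assert (E : (t * (1 - t) ^ 2 - z = 0)%R).
  { apply RtoC_inj. rewrite <- hl, !RtoC_minus, RtoC_mult, RtoC_pow, RtoC_minus. reflexivity. }
  replace z with (t * (1 - t) ^ 2)%R in hz by lra. rewrite Rabs_pos_eq in hz; lra. }
intros t Ht. split; [apply K, Ht|]. intros E. apply (K (1 - t)%R); [lra|].
rewrite RtoC_minus, <- E. ring.
Qed.

(** * Passage to the limit under the integral *)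

Lemma is_series_C_bound (a : nat -> C) (l : C) (M : R) :
  (forall n, (Cmod (csum a n - l) <= M * (1 / 2) ^ n)%R) ->
  is_series (V := C_NormedModule) a l.
Proof.
intros E. apply (filterlim_locally_ball_norm (K := C_AbsRing) (U := C_NormedModule)).
intros eps.
assert (L : is_lim_seq (fun n => M * (1 / 2) ^ n)%R (M * 0)%R).
{ apply (is_lim_seq_scal_l (fun n => (1 / 2) ^ n)%R M 0%R). apply is_lim_seq_geom.
  rewrite Rabs_pos_eq; lra. }
rewrite Rmult_0_r in L. apply is_lim_seq_spec in L.
generalize (L eps). apply filter_imp. intros n hn.
rewrite Rminus_0_r in hn. apply Rle_lt_trans with (2 := Rle_lt_trans _ _ _ (Rle_abs _) hn).
exact (E n).
Qed.

(** Interchange of sum and integral at the level of errors: the moment is linear and bounded by the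
    sup norm, so a uniform estimate for a partial sum passes to its moment unchanged. *)
Lemma log_moment_limit (f : R -> C) (h : nat -> R -> C) (c : C) (d : nat -> C) (n : nat) (M : R) :
  log_moment f c -> (forall k, log_moment (h k) (d k)) ->
  (forall x, (0 <= x <= 1)%R -> (Cmod (csum (fun k => h k x) n - f x) <= M)%R) ->
  (Cmod (csum d n - c) <= M)%R.
Proof.
intros Hf Hh B.
assert (L := log_moment_plus _ _ _ _ (log_moment_sum _ _ n Hh) (log_moment_scal _ (-1) _ Hf)).
replace (csum d n - c) with (csum d n + -1 * c) by ring.
apply log_moment_bound with (2 := L). intros x Hx.
replace (_ + -1 * f x) with (csum (fun k => h k x) n - f x) by ring. exact (B x Hx).
Qed.

Lemma log_moment_principal (m : nat) (l : C) (A : nat -> C) :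
  (forall t : R, (0 <= t <= 1)%R -> l <> t) ->
  log_moment (fun x => principal m l A x) (csum (fun r => A r * C_fun r l) m).
Proof.
intros H. unfold principal. apply log_moment_sum. intros r.
exact (log_moment_scal _ (A r) _ (log_moment_pole l r H)).
Qed.

(** This moment is the integral of ln (1 - x) times the polar part. Reflection sends 1 / (x -
    l)^(r+1) to (-1)^(r+1) / (x - (1 - l))^(r+1). *)
Lemma log_moment_principal_refl (m : nat) (l : C) (A : nat -> C) :
  (forall t : R, (0 <= t <= 1)%R -> l <> t) -> (forall t : R, (0 <= t <= 1)%R -> 1 - l <> t) ->
  log_moment (fun x => principal m l A (1 - x)%R)
    (csum (fun r => A r * ((-1) ^ S r * C_fun r (1 - l))) m).
Proof.
intros H H'. unfold principal. apply log_moment_sum. intros r.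
apply log_moment_scal.
apply log_moment_ext with (2 := log_moment_scal _ ((-1) ^ S r) _ (log_moment_pole (1 - l) r H')).
intros x Hx.
assert (N : x - (1 - l) <> 0) by apply Csub_nz, not_eq_sym, H', Hx.
rewrite RtoC_minus. replace (1 - x - l) with (- (x - (1 - l))) by ring.
rewrite Cpow_opp. assert (E := Cpow_neg1_sqr (S r)). assert (Ne := Cpow_neg1_nz (S r)).
replace (/ ((-1) ^ S r * (x - (1 - l)) ^ S r)) with
  (((-1) ^ S r * (-1) ^ S r) / ((-1) ^ S r * (x - (1 - l)) ^ S r)).
- field. split; [apply Cpow_nz, N | exact Ne].
- rewrite E. unfold Cdiv. ring.
Qed.

(** For t = u / z the sum is 1 / z times the truncated generating function, with limit t^m /
    ((1-t)^(m+1) z) = (-1)^(m+1) u^m / (u-z)^(m+1). The factor 1 / z does not enlarge the error, as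
    |z| >= 1. *)
Lemma remainder_bound (m n : nat) (z x : R) : (1 <= Rabs z)%R -> (0 <= x <= 1)%R ->
  (Cmod (csum (fun k => RtoC (binom k m / z ^ (k + 1)) * RtoC (x ^ k * (1 - x) ^ (2 * k)))%C n
     - (-1) ^ S m * ((x * (1 - x) ^ 2) ^ m / (x * (1 - x) ^ 2 - z) ^ S m)) <= (1 / 2) ^ n)%R.
Proof.
intros hz Hx. assert (B := unit_interval_bound x Hx).
assert (Nz : z <> 0%R) by (intros ->; rewrite Rabs_R0 in hz; lra).
set (u := (x * (1 - x) ^ 2)%R) in *.
assert (Hz : (0 < / Rabs z <= 1)%R).
{ split; [apply Rinv_0_lt_compat; lra|]. rewrite <- Rinv_1. apply Rinv_le_contravar; lra. }
assert (Ht : (Rabs (u / z) <= 1 / 4)%R).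
{ unfold Rdiv. rewrite Rabs_mult, Rabs_inv, (Rabs_pos_eq u) by lra. nra. }
assert (H := binom_gen_remainder m n (u / z) Ht).
assert (N1 : (1 - u / z <> 0)%R).
{ apply Rabs_le_between in Ht. lra. }
set (T := sum_n (fun k => binom k m * (u / z) ^ k)%R n) in *.
assert (E1 : csum (fun k => RtoC (binom k m / z ^ (k + 1)) * RtoC (x ^ k * (1 - x) ^ (2 * k))) n
  = RtoC (T / z)).
{ unfold T. clear - Nz. induction n as [|n IH].
  - rewrite !sum_O, <- RtoC_mult. f_equal. simpl. field. exact Nz.
  - rewrite !sum_Sn, IH. change plus with Cplus at 1. change plus with Rplus.
    rewrite <- RtoC_mult, <- RtoC_plus. f_equal.
    replace ((u / z) ^ S n)%R with (x ^ S n * (1 - x) ^ (2 * S n) / z ^ S n)%R.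
    + rewrite pow_add. field. split; [apply pow_nonzero|]; exact Nz.
    + unfold u, Rdiv. rewrite !Rpow_mult_distr, pow_inv, <- pow_mult. reflexivity. }
assert (E2 : (-1) ^ S m * ((x * (1 - x) ^ 2) ^ m / (x * (1 - x) ^ 2 - z) ^ S m)
  = RtoC ((u / z) ^ m / (1 - u / z) ^ S m / z)).
{ replace (RtoC x * (1 - x) ^ 2) with (RtoC u)
    by (unfold u; rewrite RtoC_mult, RtoC_pow, RtoC_minus; reflexivity).
  assert (N2 : (u - z <> 0)%R).
  { intros e. apply N1. replace u with z by lra. field. exact Nz. }
  rewrite <- RtoC_minus, <- !RtoC_pow, <- RtoC_div, <- RtoC_mult by (apply pow_nonzero; exact N2).
  f_equal.
  replace (1 - u / z)%R with (-1 * (u - z) * / z)%R by (field; exact Nz).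
  assert (Es : ((-1) ^ S m * (-1) ^ S m = 1)%R).
  { rewrite <- Rpow_mult_distr. replace (-1 * -1)%R with 1%R by ring. apply pow1. }
  assert (Ne : ((-1) ^ S m <> 0)%R) by (apply pow_nonzero; lra).
  unfold Rdiv. rewrite !Rpow_mult_distr, !pow_inv.
  transitivity ((-1) ^ S m * (-1) ^ S m * (u ^ m * / z ^ m * / ((-1) ^ S m * (u - z) ^ S m * / z ^ S m) * / z))%R.
  - simpl (z ^ S m)%R. field. repeat split; trivial; apply pow_nonzero; assumption.
  - rewrite Es. ring. }
rewrite E1, E2, <- RtoC_minus, Cmod_R.
replace (T / z - (u / z) ^ m / (1 - u / z) ^ S m / z)%R
  with (- (/ z * ((u / z) ^ m / (1 - u / z) ^ S m - T)))%R by (unfold Rdiv; ring).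
rewrite Rabs_Ropp, Rabs_mult, Rabs_inv.
assert (P := Rabs_pos ((u / z) ^ m / (1 - u / z) ^ S m - T)). nra.
Qed.

Theorem theorem7 (m : nat) (z : R) (hz : (1 <= Rabs z)%R)
  (z1 z2 z3 : C)
  (h1 : z1 * (1 - z1) ^ 2 - z = 0)
  (h2 : z2 * (1 - z2) ^ 2 - z = 0)
  (h3 : z3 * (1 - z3) ^ 2 - z = 0)
  (h12 : z1 <> z2) (h13 : z1 <> z3) (h23 : z2 <> z3) :
  let F (l : C) : C :=
    sum_n (fun j => a_coef m z j l * (C_fun j l + (-1) ^ j * C_fun j (1 - l))) m in
  is_series (V := C_NormedModule)
    (fun k : nat =>
       RtoC ((harmonic (2 * k) - harmonic k)
             / (INR (3 * k + 1) * binom (3 * k) k)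
             * (binom k m / z ^ (k + 1)))%R)
    ((-1) ^ m * (F z1 + F z2 + F z3)).
Proof.
intros F.
assert (Hu := cubic_roots z z1 z2 z3 h1 h2 h3 h12 h13 h23).
destruct (pfrac_pow z z1 z2 z3 (fun x => x * (1 - x) ^ 2) m h12 h13 h23 Hu) as [A HA].
cbv beta in HA.
assert (O1 := root_off_unit_interval z z1 hz h1).
assert (O2 := root_off_unit_interval z z2 hz h2).
assert (O3 := root_off_unit_interval z z3 hz h3).
assert (C1 : forall r, (r <= m)%nat -> a_coef m z r z1 = A z1 r).
{ intros r hr. exact (a_coef_principal m r z z1 z2 z3 _ _ _ h12 h13 hr HA). }
assert (C2 : forall r, (r <= m)%nat -> a_coef m z r z2 = A z2 r).
{ intros r hr. apply (a_coef_principal m r z z2 z1 z3 (A z2) (A z1) (A z3)); auto.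
  intros x e2 e1 e3. rewrite HA by assumption. ring. }
assert (C3 : forall r, (r <= m)%nat -> a_coef m z r z3 = A z3 r).
{ intros r hr. apply (a_coef_principal m r z z3 z1 z2 (A z3) (A z1) (A z2)); auto.
  intros x e3 e1 e2. rewrite HA by assumption. ring. }
set (L := fun l => csum (fun r => A l r * C_fun r l) m).
set (L' := fun l => csum (fun r => A l r * ((-1) ^ S r * C_fun r (1 - l))) m).
(* [L] and [L'] are the moments of a polar part against ln x and ln (1 - x). The plus sign in [F]
   becomes a minus because reflection contributes (-1)^(j+1) and not (-1)^j. *)
assert (HF : forall l, (forall r, (r <= m)%nat -> a_coef m z r l = A l r) -> F l = L l - L' l).
{ intros l Hl. unfold F, L, L'.
  transitivity (csum (fun r => A l r * C_fun r l) m
    + (-1) * csum (fun r => A l r * ((-1) ^ S r * C_fun r (1 - l))) m); [|ring].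
  rewrite <- sum_n_Cmult, <- csum_plus. apply sum_n_ext_loc. intros r hr.
  rewrite Hl by exact hr. rewrite Cpow_S. as_C. ring. }
rewrite (HF z1 C1), (HF z2 C2), (HF z3 C3). clear F HF C1 C2 C3.
set (w := fun k => RtoC (binom k m / z ^ (k + 1))).
assert (M1 := log_moment_scal _ ((-1) ^ S m) _ (log_moment_plus _ _ _ _ (log_moment_plus _ _ _ _
  (log_moment_principal m z1 (A z1) (fun t Ht => proj1 (O1 t Ht)))
  (log_moment_principal m z2 (A z2) (fun t Ht => proj1 (O2 t Ht))))
  (log_moment_principal m z3 (A z3) (fun t Ht => proj1 (O3 t Ht))))).
assert (M2 := log_moment_scal _ ((-1) ^ S m) _ (log_moment_plus _ _ _ _ (log_moment_plus _ _ _ _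
  (log_moment_principal_refl m z1 (A z1) (fun t Ht => proj1 (O1 t Ht)) (fun t Ht => proj2 (O1 t Ht)))
  (log_moment_principal_refl m z2 (A z2) (fun t Ht => proj1 (O2 t Ht)) (fun t Ht => proj2 (O2 t Ht))))
  (log_moment_principal_refl m z3 (A z3) (fun t Ht => proj1 (O3 t Ht)) (fun t Ht => proj2 (O3 t Ht))))).
fold (L z1) (L z2) (L z3) in M1. fold (L' z1) (L' z2) (L' z3) in M2.
(* [d k] and [d' k] are the moments of w_k x^k (1-x)^(2k) against ln x and ln (1 - x). They share
   the Beta factor and H_(3k+1), so that [d' k - d k] retains H_2k - H_k. *)
set (d := fun k => w k * RtoC (INR (fact k) * INR (fact (2 * k)) / INR (fact (k + 2 * k + 1)) *
   (harmonic k - harmonic (k + 2 * k + 1)))).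
set (d' := fun k => w k * RtoC (INR (fact (2 * k)) * INR (fact k) / INR (fact (2 * k + k + 1)) *
   (harmonic (2 * k) - harmonic (2 * k + k + 1)))).
assert (B : forall x : R, (0 <= x <= 1)%R -> forall n,
  (Cmod (csum (fun k => w k * RtoC (x ^ k * (1 - x) ^ (2 * k)))%C n -
    (-1) ^ S m * (principal m z1 (A z1) x + principal m z2 (A z2) x + principal m z3 (A z3) x))
   <= (1 / 2) ^ n)%R).
{ intros x Hx n. rewrite <- HA.
  - exact (remainder_bound m n z x hz Hx).
  - apply not_eq_sym, (O1 x Hx).
  - apply not_eq_sym, (O2 x Hx).
  - apply not_eq_sym, (O3 x Hx). }
(* One error (1/2)^n for each of the two logarithms. *)
apply is_series_C_bound with (M := 2%R). intros n.
assert (K1 : (Cmod (csum d n - (-1) ^ S m * (L z1 + L z2 + L z3)) <= (1 / 2) ^ n)%R).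
{ apply log_moment_limit with (1 := M1)
    (h := fun k (x : R) => w k * RtoC (x ^ k * (1 - x) ^ (2 * k))).
  - intros k. apply log_moment_scal, log_moment_beta.
  - intros x Hx. exact (B x Hx n). }
assert (K2 : (Cmod (csum d' n - (-1) ^ S m * (L' z1 + L' z2 + L' z3)) <= (1 / 2) ^ n)%R).
{ apply log_moment_limit with (1 := M2)
    (h := fun k (x : R) => w k * RtoC ((1 - x) ^ k * (1 - (1 - x)) ^ (2 * k))).
  - intros k. apply log_moment_scal.
    apply log_moment_ext with (2 := log_moment_beta (2 * k) k).
    intros x _. replace (1 - (1 - x))%R with x by ring. f_equal. ring.
  - intros x Hx. apply (B (1 - x)%R). lra. }
match goal with |- (Cmod (?S - _) <= _)%R => replace S with (csum d' n - csum d n) end.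
- match goal with |- (Cmod ?e <= _)%R => replace e with
    ((csum d' n - (-1) ^ S m * (L' z1 + L' z2 + L' z3))
     + - (csum d n - (-1) ^ S m * (L z1 + L z2 + L z3))) by (rewrite Cpow_S; ring) end.
  apply Rle_trans with (1 := Cmod_triangle _ _). rewrite Cmod_opp. lra.
- transitivity (csum d' n + (-1) * csum d n); [ring|].
  rewrite <- sum_n_Cmult, <- csum_plus. apply sum_n_ext. intros k. as_C.
  unfold d, d', w. rewrite <- !RtoC_mult, <- RtoC_plus. f_equal.
  replace (binom (3 * k) k) with (Binomial.C (3 * k) k)
    by (unfold binom; rewrite (proj2 (Nat.leb_le k (3 * k))) by lia; reflexivity).
  (* What remains is k! (2k)! / (3k+1)! = 1 / ((3k+1) binom(3k,k)). *)
  unfold Binomial.C.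
  replace (3 * k - k)%nat with (2 * k)%nat by lia.
  replace (k + 2 * k + 1)%nat with (S (3 * k)) by lia.
  replace (2 * k + k + 1)%nat with (S (3 * k)) by lia.
  replace (3 * k + 1)%nat with (S (3 * k)) by lia.
  rewrite (fact_simpl (3 * k)), mult_INR.
  assert (Nz : z <> 0%R) by (intros ->; rewrite Rabs_R0 in hz; lra).
  field. repeat split; try apply INR_fact_neq_0; try (apply pow_nonzero; exact Nz).
  apply not_0_INR. lia.
Qed.
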